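(* Let $f:\mathbb{R}^-\times\mathbb{R}^-\to\mathbb{R}$, $f=f(x,y)$, be a $C^3$ function defining a perfect (equilibrium) pseudo-statistical fluid, with generating function $$\chi_{\rm eq}(\zeta,\zeta^a)=\int f(\zeta,\,p_a\zeta^a)\,d\omega ,$$ such that this equilibrium theory is well defined. If the equilibrium theory is manifestly causal, i.e. $$f_{xxy}\ge 0,\qquad f_{yyy}\ge 0,\qquad (f_{xyy})^2\le f_{yyy}\,f_{xxy},$$ then the extended dissipative theory, i.e. the divergence type theory whose generating function $\chi(\zeta,\zeta^a,\zeta^{ab})$ is equal to $$\int f(\zeta+p_ap_b\zeta^{ab},\,p_a\zeta^a)\,d\omega \qquad\text{for } \zeta^{ab}\in C^-$$ and is any smooth extension of this expression to the remaining values of $\zeta^{ab}$ in a neighborhood of equilibrium, is causal in a neighborhood of equilibrium: every equilibrium state $(\zeta,\zeta^a,0)$ has a neighborhood, in the space of states $(\zeta,\zeta^a,\zeta^{ab})$, at every point of which the theory is causal.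
   Context: Setting. Work on (the tangent space at a point of) a 4-dimensional time-oriented Lorentzian spacetime with metric $g_{ab}$ of signature $(-,+,+,+)$; indices are raised and lowered with $g_{ab}$. Fix a mass $m>0$. All integrals $\int\cdots d\omega$ are over the future mass shell $\{p_a \text{ future-directed}: p^ap_a=-m^2\}$ with respect to its Lorentz-invariant volume element $d\omega$. Subscripts $x,y$ on $f$ denote partial derivatives with respect to its first and second argument. States. The dynamical variables (states) are $\zeta^A=(\zeta,\zeta^a,\zeta^{ab})$ with $\zeta<0$ a real number, $\zeta^a$ a future-directed timelike vector, and $\zeta^{ab}$ a symmetric trace-free ($g_{ab}\zeta^{ab}=0$) tensor. Thus $p_a\zeta^a<0$ for every $p_a$ in the future mass shell. Equilibrium states are those with $\zeta^{ab}=0$. Divergence type theory. A theory is determined by a scalar generating function $\chi(\zeta,\zeta^a,\zeta^{ab})$ together with a dissipation-source tensor $I^{ab}$; the field equations are $\nabla_aN^a=0$, $\nabla_aT^{ab}=0$, $\nabla_aA^{abc}=I^{bc}$ with $$N_a=\frac{\partial^2\chi}{\partial\zeta\,\partial\zeta^a},\quad T_{ab}=\frac{\partial^2\chi}{\partial\zeta^a\partial\zeta^b},\quad A_{abc}=\frac{\partial^2\chi}{\partial\zeta^a\partial\zeta^{bc}} .$$ Equivalently $M^a_{AB}\nabla_a\zeta^B=I_A$, where $I_A=(0,0,I_{ab})$ and $M^a_{AB}=\dfrac{\partial^3\chi}{\partial\zeta_a\,\partial\zeta^A\,\partial\zeta^B}$. (Derivatives with respect to $\zeta^{ab}$ are along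 symmetric trace-free tensors.) Causality. The theory is causal at a state if for every nonzero perturbation $Z^A=(\delta\zeta,\delta\zeta^a,\delta\zeta^{ab})$ (with $\delta\zeta^{ab}$ symmetric and trace-free) the vector $E^a=\tfrac12 M^a_{AB}Z^AZ^B$, with $M^a_{AB}$ evaluated at that state, is future-directed timelike; the condition is expressed as $t_aE^a<0$ for all future-directed timelike $t_a$. Pseudo-statistical theories. A dissipative fluid theory of divergence type is of pseudo-statistical origin if its generating function can be written $\chi(\zeta,\zeta^a,\zeta^{ab})=\int f(\zeta+p_ap_b\zeta^{ab},\,p_a\zeta^a)\,d\omega$ for a scalar function $f=f(x,y)$ of two variables, $x=\zeta+p_ap_b\zeta^{ab}$, $y=p_a\zeta^a$; the corresponding perfect (equilibrium) fluid is obtained by setting $\zeta^{ab}=0$ (and $I^{ab}=0$). ''The equilibrium theory is well defined'' means that $f$ decays fast enough to make the integral defining $\chi_{\rm eq}$ well defined and $\chi_{\rm eq}$ smooth in all its variables. The cone. $C^-=\{\zeta^{ab}\;:\;\zeta^{ab}=\zeta^{ba},\ g_{ab}\zeta^{ab}=0,\ l_al_b\zeta^{ab}\le 0 \text{ for all null } l_a\}$. For $\zeta^{ab}\in C^-$ the argument $\zeta+p_ap_b\zeta^{ab}$ is negative for all $p_a$ in the future mass shell. Extended dissipative theory. Its generating function is $\int f(\zeta+p_ap_b\zeta^{ab},p_a\zeta^a)\,d\omega$ for $\zeta^{ab}\in C^-$. It is a standing assumption that this function has been extended smoothly, in an otherwise arbitrary way, to values of $\zeta^{ab}\notin C^-$,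 so that $\chi$ is smooth in a neighborhood of the equilibrium states.
   Formalization: Adds a nondegeneracy condition: at each equilibrium state, no nonzero perturbation makes f_xxy δx²+2f_xyy δxδy+f_yyy δy² (δx=δζ+p_ap_bδζ^{ab}, δy=p_aδζ^a) vanish on the whole mass shell; without it the claim fails, e.g. f=0 gives E^a=0. *)

(* Defs.v *)
(* MathComp / MathComp-Analysis. *)
From HB Require Import structures.
From mathcomp Require Import all_boot all_order all_algebra.
From mathcomp Require Import all_classical all_reals all_analysis.
From mathcomp Require Import ring lra.

Set Implicit Arguments.
Unset Strict Implicit.
Unset Printing Implicit Defensive.

Import Order.TTheory GRing.Theory Num.Theory.
Import numFieldNormedType.Exports.

Local Open Scope classical_set_scope.
Local Open Scope ring_scope.

(* [Ck n O W g]: [g] is of class C^n on the set [O `&` W], derivatives being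
   taken along the directions in [W].  It is meant for [O] open and [W] a linear
   subspace (finite-dimensional in every use), so that [O `&` W] is an arbitrary
   open subset of [W] and only the values of [g] there matter; continuity is
   with respect to the subspace topology of [O `&` W]. *)
Fixpoint Ck (R : realType) (V : normedModType R) (n : nat) (O W : set V)
    (g : V -> R) : Prop :=
  {within O `&` W, continuous g} /\
  match n with
  | 0 => True
  | k.+1 => (forall x v, (O `&` W) x -> W v -> derivable (g : V -> R^o) x v) /\
            (forall v, W v -> Ck k O W ('D_v (g : V -> R^o)))
  end.

Definition smooth (R : realType) (V : normedModType R) (O W : set V)
    (g : V -> R) : Prop := forall n, Ck n O W g.

(* The tangent space, in a time-oriented orthonormal frame, is 'cV[R]_4 with the
   metric diag(-1,1,1,1) and the positive time axis in the future.  Vectors v^a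
   are columns, covectors p_a are rows and tensors T^{ab} are 4 x 4 matrices. *)
Section Minkowski.
Variable R : realType.
Implicit Types (v : 'cV[R]_4) (p : 'rV[R]_4) (T : 'M[R]_4).

(* both g_{ab} and g^{ab} *)
Definition eta : 'M[R]_4 := diag_mx (\row_a (if a == 0 then -1 else 1)).

(* p_a v^a *)
Definition pairing p v : R := (p *m v) 0 0.

(* p_a p_b T^{ab} *)
Definition quad p T : R := (p *m T *m p^T) 0 0.

(* p^a = g^{ab} p_b *)
Definition sharp p : 'cV[R]_4 := eta *m p^T.

Definition future_timelike v : Prop := (v^T *m eta *m v) 0 0 < 0 /\ 0 < v 0 0.

Definition null_covector p : Prop := pairing p (sharp p) = 0.

Definition sym_tracefree T : Prop := T^T = T /\ \tr (eta *m T) = 0.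

Definition Cminus T : Prop :=
  sym_tracefree T /\ forall l, null_covector l -> quad l T <= 0.

Definition mass_shell (m : R) : set 'rV[R]_4 :=
  [set p | future_timelike (sharp p) /\ pairing p (sharp p) = - m ^+ 2].

(* The mass shell is parametrized by the spatial momentum k, the energy being
   p^0 = - p_0. *)
Definition energy (m : R) (k : R * R * R) : R :=
  Num.sqrt (m ^+ 2 + (k.1.1 ^+ 2 + k.1.2 ^+ 2 + k.2 ^+ 2)).

Definition shell_point (m : R) (k : R * R * R) : 'rV[R]_4 :=
  \row_(a < 4) [:: - energy m k; k.1.1; k.1.2; k.2]`_a.

Definition lebesgue3 :=
  (@lebesgue_measure R \x @lebesgue_measure R \x @lebesgue_measure R)%E.

(* The invariant volume element is normalized as d\omega = d^3 k / p^0. *)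
Definition shell_integrable (m : R) (g : 'rV[R]_4 -> R) : Prop :=
  lebesgue3.-integrable setT
    (fun k => (g (shell_point m k) / energy m k)%:E).

Definition shell_integral (m : R) (g : 'rV[R]_4 -> R) : R :=
  \int[lebesgue3]_(k in setT) (g (shell_point m k) / energy m k).

End Minkowski.
Arguments eta {R}.

Section Parametrization.
Variable R : realType.

Let sum4 (F : 'I_4 -> R) :
  \sum_i F i = F 0 + F 1 + F (inord 2) + F (inord 3).
Proof.
rewrite !big_ord_recr big_ord0 /= add0r.
by congr (F _ + F _ + F _ + F _); apply/val_inj; rewrite /= ?inordK.
Qed.

Lemma mass_shellP (m : R) (p : 'rV[R]_4) : 0 < m ->
  mass_shell m p <-> exists k, p = shell_point m k.
Proof.
move=> m0.
have sE (q : 'rV[R]_4) a :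
    sharp q a 0 = (if a == 0 then -1 else 1) * q 0 a.
  by rewrite /sharp /eta mul_diag_mx !mxE.
have e2 : (inord 2 == 0 :> 'I_4) = false by rewrite -val_eqE /= inordK.
have e3 : (inord 3 == 0 :> 'I_4) = false by rewrite -val_eqE /= inordK.
have pE (q : 'rV[R]_4) : pairing q (sharp q) =
    - q 0 0 ^+ 2 + q 0 1 ^+ 2 + q 0 (inord 2) ^+ 2 + q 0 (inord 3) ^+ 2.
  rewrite /pairing mxE sum4 !sE eqxx e2 e3 /=; ring.
have tE (q : 'rV[R]_4) :
    ((sharp q)^T *m eta *m sharp q) 0 0 = pairing q (sharp q).
  congr ((_ *m _) 0 0); apply/rowP => a.
  rewrite /eta mul_mx_diag mxE [_^T _ _]mxE sE mxE.
  by case: ifP => _; ring.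
split=> [[[_]] + | [k ->]].
- rewrite sE eqxx pE => p0 pm.
  exists (p 0 1, p 0 (inord 2), p 0 (inord 3)).
  have eE : energy m (p 0 1, p 0 (inord 2), p 0 (inord 3)) = - p 0 0.
    rewrite /energy /=; set x := (X in Num.sqrt X).
    have -> : x = (- p 0 0) ^+ 2 by rewrite /x sqrrN; move: pm; lra.
    by rewrite sqrtr_sqr ger0_norm //; move: p0; lra.
  apply/rowP => a; rewrite mxE eE /=.
  by case: a => [[|[|[|[|//]]]]] i; rewrite ?opprK /=;
    congr (p 0 _); apply/val_inj; rewrite /= ?inordK.
- have x0 : 0 < m ^+ 2 + (k.1.1 ^+ 2 + k.1.2 ^+ 2 + k.2 ^+ 2).
    by rewrite ltr_pwDl ?exprn_gt0 // !addr_ge0 // sqr_ge0.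
  have E0 : 0 < energy m k by rewrite sqrtr_gt0.
  have pm : pairing (shell_point m k) (sharp (shell_point m k)) = - m ^+ 2.
    rewrite pE !mxE /= !inordK //= sqrrN /energy sqr_sqrtr ?ltW //; lra.
  split=> //; split; last by rewrite sE eqxx mxE /=; lra.
  by rewrite tE pm oppr_lt0 exprn_gt0.
Qed.

End Parametrization.

Section Fluids.
Variable R : realType.

(* (zeta, zeta^a, zeta^{ab}); the same type is used for states and for
   perturbations. *)
Definition fields : normedModType R := (R^o * 'cV[R]_4 * 'M[R]_4)%type.

(* the linear space in which the states form an open set *)
Definition perturbation : set fields := [set Z | sym_tracefree Z.2].

Definition states : set fields :=
  [set s | [/\ s.1.1 < 0, future_timelike s.1.2 & sym_tracefree s.2]].

Definition equilibrium : set fields := [set s | states s /\ s.2 = 0].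

(* [mform chi s a Z Z'] is M_{a A B} Z^A Z'^B at the state [s], with the index
   [a] of d/d zeta^a down. *)
Definition mform (chi : fields -> R) (s : fields) (a : 'I_4) (Z Z' : fields)
    : R :=
  'D_((0, delta_mx a 0, 0) : fields)
    ('D_Z ('D_Z' (chi : fields -> R^o))) s.

(* E^a = (1/2) g^{ab} M_{b A B} Z^A Z^B *)
Definition E_vector (chi : fields -> R) (s Z : fields) : 'cV[R]_4 :=
  2^-1 *: (eta *m \col_a mform chi s a Z Z).

Definition causal_at (chi : fields -> R) (s : fields) : Prop :=
  forall Z, perturbation Z -> Z != 0 -> future_timelike (E_vector chi s Z).

Section Pseudo_statistical.
Variables (m : R) (f : R^o * R^o -> R).

Definition quadrant : set (R^o * R^o) := [set z | z.1 < 0 /\ z.2 < 0].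

Definition dx (g : R^o * R^o -> R) : R^o * R^o -> R :=
  'D_((1, 0) : R^o * R^o) (g : _ -> R^o).
Definition dy (g : R^o * R^o -> R) : R^o * R^o -> R :=
  'D_((0, 1) : R^o * R^o) (g : _ -> R^o).

Definition equilibrium_integrand (s : R^o * 'cV[R]_4) (p : 'rV[R]_4) : R :=
  f (s.1, pairing p s.2).

Definition chi_eq (s : R^o * 'cV[R]_4) : R :=
  shell_integral m (equilibrium_integrand s).

Definition equilibrium_domain : set (R^o * 'cV[R]_4) :=
  [set s | s.1 < 0 /\ future_timelike s.2].

Definition equilibrium_well_defined : Prop :=
  (forall s, equilibrium_domain s ->
     shell_integrable m (equilibrium_integrand s)) /\
  smooth equilibrium_domain setT chi_eq.

Definition manifestly_causal : Prop := forall z, quadrant z ->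
  [/\ 0 <= dy (dx (dx f)) z, 0 <= dy (dy (dy f)) z &
      dy (dy (dx f)) z ^+ 2 <= dy (dy (dy f)) z * dy (dx (dx f)) z].

(* f_xxy dx^2 + 2 f_xyy dx dy + f_yyy dy^2 with
   dx = delta zeta + p_a p_b delta zeta^{ab} and dy = p_a delta zeta^a; formally,
   E^a is half the integral of p^a times this form. *)
Definition causality_integrand (s Z : fields) (p : 'rV[R]_4) : R :=
  let z := (s.1.1 + quad p s.2, pairing p s.1.2) in
  let delta_x := Z.1.1 + quad p Z.2 in
  let delta_y := pairing p Z.1.2 in
  dy (dx (dx f)) z * delta_x ^+ 2 + 2 * dy (dy (dx f)) z * delta_x * delta_y
  + dy (dy (dy f)) z * delta_y ^+ 2.

(* The weak inequalities of [manifestly_causal] bound E^a only up to degenerate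
   cases: f = 0 and f(x,y) = exp y satisfy them, although E^a = 0 for all Z,
   respectively for Z = (1,0,0).  This condition excludes exactly those cases: no
   nonzero perturbation of an equilibrium state makes the integrand of E^a vanish
   on the whole mass shell.  The Boltzmann function exp(x + y) satisfies it
   although its quadratic form has rank one everywhere: the perturbation would
   satisfy delta zeta + p_a delta zeta^a + p_a p_b delta zeta^{ab} = 0 on the
   shell. *)
Definition causality_nondegenerate : Prop := forall s Z,
  equilibrium s -> perturbation Z -> Z != 0 ->
  exists2 p, mass_shell m p & causality_integrand s Z p != 0.

Definition integrand (s : fields) (p : 'rV[R]_4) : R :=
  f (s.1.1 + quad p s.2, pairing p s.1.2).

Definition extended_generating_function (chi : fields -> R) : Prop :=
  (forall s, states s -> Cminus s.2 ->
     shell_integrable m (integrand s) /\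
     chi s = shell_integral m (integrand s)) /\
  (exists O : set fields,
     [/\ open O, equilibrium `<=` O & smooth O perturbation chi]).

End Pseudo_statistical.
End Fluids.

(* Main.v *)
(* The sign of the causality form is transferred from f to chi by finite
   differences, so that no domination is needed to differentiate under the
   integral.  For a momentum p the third difference of f(zeta + p p zeta, p zeta),
   taken once along a future causal t and twice along Z, is h^3 times p_a t^a < 0
   times the nonnegative quadratic form of the manifest causality condition, at an
   intermediate point; by nondegeneracy it is at most - c h^3 for p in some
   box of the mass shell.  Integrating, the third difference of chi, which is
   h^3 D_t D_Z D_Z chi at an intermediate point, is at most - c h^3 times the
   measure of the box.  These differences need the representation of chi, hence
   zeta^{ab} in C^-; at an equilibrium state, which sits at the vertex of C^-, they
   are based at a point shifted by a small multiple of an interior direction of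
   C^-, and the shift is removed by the continuity of the third derivatives of the
   smooth extension.  So E^a is future timelike at equilibrium for every Z != 0, and
   compactness of the unit sphere of perturbations propagates this to a
   neighbourhood. *)

Require Import Defs.
From HB Require Import structures.
From mathcomp Require Import all_boot all_order all_algebra.
From mathcomp Require Import all_classical all_reals all_analysis.
From mathcomp Require Import ring lra.

Import Order.TTheory GRing.Theory Num.Theory.
Import numFieldNormedType.Exports.

Set Implicit Arguments.
Unset Strict Implicit.
Unset Printing Implicit Defensive.

Local Open Scope classical_set_scope.
Local Open Scope ring_scope.

(** * Finite differences and the mean value theorem *)

Definition difference {R : realType} {V : normedModType R} (c : V)
  (g : V -> R^o) : V -> R^o := fun x => g (x + c) - g x.

Section Directional_calculus.
Context {R : realType} {V : normedModType R}.
Implicit Types (g : V -> R^o) (x y u v w d : V) (O W : set V) (a b c h : R).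

Lemma is_derive_line g x v (r : R) :
  derivable g (x + r *: v) v ->
  is_derive r (1 : R) (fun r : R => g (x + r *: v) : R^o)
    ('D_v g (x + r *: v)).
Proof.
move=> dg; have E : (fun h : R => h^-1 *:
    (((fun r : R => g (x + r *: v) : R^o) \o shift r) (h *: (1 : R)) -
      g (x + r *: v))) =
    (fun h => h^-1 *: ((g \o shift (x + r *: v)) (h *: v) - g (x + r *: v))).
  apply/funext => h /=; rewrite /shift /=.
  have -> : (h *: (1 : R) : R) = h by rewrite -[LHS]/(h * 1) mulr1.
  by rewrite scalerDl addrCA.
by split; rewrite /derivable /derive E.
Qed.

(** This is the one-variable theorem for r -> g (x + r v). The nonstrict bounds admit a zero step,
    which occurs below for [h * a] with [a = 0]. *)
Lemma directional_MVT g x v (h : R) : 0 <= h ->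
  (forall r, 0 <= r <= h -> derivable g (x + r *: v) v) ->
  exists2 r, 0 <= r <= h & difference (h *: v) g x = h * 'D_v g (x + r *: v).
Proof.
move=> h0 dg; pose phi (r : R) : R^o := g (x + r *: v).
have dphi r : 0 <= r <= h -> is_derive r (1 : R) phi ('D_v g (x + r *: v)).
  by move=> /dg; exact: is_derive_line.
have [r rI||r] := @MVT_segment R phi (fun r => 'D_v g (x + r *: v)) 0 h h0.
- by apply: dphi; move: rI; rewrite in_itv /= => /andP[/ltW -> /ltW ->].
- apply: derivable_within_continuous => r; rewrite in_itv /= => /dphi rI.
  exact: ex_derive.
rewrite in_itv /= subr0 => rI E; exists r => //.
by rewrite /difference mulrC -E /phi scale0r addr0.
Qed.

Lemma is_derive_shift g x d v : derivable g (x + d) v ->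
  is_derive x v (fun y => g (y + d)) ('D_v g (x + d)).
Proof.
move=> dg; have E : (fun h : R => h^-1 *:
    (((fun y => g (y + d)) \o shift x) (h *: v) - g (x + d))) =
    (fun h => h^-1 *: ((g \o shift (x + d)) (h *: v) - g (x + d))).
  by apply/funext => h /=; rewrite /shift /= addrA.
by split; rewrite /derivable /derive E.
Qed.

Lemma is_derive_difference g x d v :
  derivable g x v -> derivable g (x + d) v ->
  is_derive x v (difference d g) (difference d ('D_v g) x).
Proof.
move=> dgx dgc; have := is_derive_shift dgc; have := derivableP dgx => d1 d2.
exact: is_deriveB.
Qed.

(** The mean value theorem turns the outer difference into the inner difference of D_v g, and then
    applies again along u; so the outermost step becomes the innermost derivative. The set [P] only
    has to contain the parallelogram of the steps. *)
Lemma second_difference g x u v (h : R) (P : set V) : 0 <= h ->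
  (forall a b, 0 <= a <= h -> 0 <= b <= h -> P (x + b *: v + a *: u)) ->
  (forall y, P y -> derivable g y v /\ derivable ('D_v g) y u) ->
  exists a b, [/\ 0 <= a <= h, 0 <= b <= h &
    difference (h *: v) (difference (h *: u) g) x =
    h ^+ 2 * 'D_u ('D_v g) (x + b *: v + a *: u)].
Proof.
move=> h0 Px dg; have h0h : 0 <= h <= h by rewrite h0 lexx.
have h00 : 0 <= (0 : R) <= h by rewrite h0 lexx.
have dD b : 0 <= b <= h -> is_derive (x + b *: v) v (difference (h *: u) g)
    (difference (h *: u) ('D_v g) (x + b *: v)).
  move=> bh; apply: is_derive_difference.
    by have := (dg _ (Px 0 b h00 bh)).1; rewrite scale0r addr0.
  by have := (dg _ (Px h b h0h bh)).1.
have [b bh ->] := directional_MVT h0 (fun b bh => ex_derive (is_derive := dD b bh)).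
have -> := derive_val (is_derive := dD b bh).
have [a ah ->] := @directional_MVT ('D_v g) (x + b *: v) u h h0
  (fun a ah => (dg _ (Px a b ah bh)).2).
by exists a, b; split=> //; rewrite mulrA expr2.
Qed.

(** Peeling off the outermost step along w leaves a second difference of D_w g. *)
Lemma third_difference g x u v w (h : R) (P : set V) : 0 <= h ->
  (forall a b c, 0 <= a <= h -> 0 <= b <= h -> 0 <= c <= h ->
    P (x + c *: w + b *: v + a *: u)) ->
  (forall y, P y -> [/\ derivable g y w, derivable ('D_w g) y v &
    derivable ('D_v ('D_w g)) y u]) ->
  exists a b c, [/\ 0 <= a <= h, 0 <= b <= h, 0 <= c <= h &
    difference (h *: w) (difference (h *: v) (difference (h *: u) g)) x =
    h ^+ 3 * 'D_u ('D_v ('D_w g)) (x + c *: w + b *: v + a *: u)].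
Proof.
move=> h0 Px dg; have h0h : 0 <= h <= h by rewrite h0 lexx.
have h00 : 0 <= (0 : R) <= h by rewrite h0 lexx.
have dg1 a b c : 0 <= a <= h -> 0 <= b <= h -> 0 <= c <= h ->
    derivable g (x + c *: w + b *: v + a *: u) w.
  by move=> ah bh ch; have [] := dg _ (Px a b c ah bh ch).
have dD c : 0 <= c <= h -> is_derive (x + c *: w) w
    (difference (h *: v) (difference (h *: u) g))
    (difference (h *: v) (difference (h *: u) ('D_w g)) (x + c *: w)).
  move=> ch.
  have d0 : is_derive (x + c *: w) w (difference (h *: u) g)
      (difference (h *: u) ('D_w g) (x + c *: w)).
    apply: is_derive_difference.
      by have := dg1 0 0 c h00 h00 ch; rewrite !scale0r !addr0.
    by have := dg1 h 0 c h0h h00 ch; rewrite !scale0r !addr0.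
  have d1 : is_derive (x + c *: w + h *: v) w (difference (h *: u) g)
      (difference (h *: u) ('D_w g) (x + c *: w + h *: v)).
    apply: is_derive_difference.
      by have := dg1 0 h c h00 h0h ch; rewrite scale0r addr0.
    exact: dg1.
  have := is_derive_difference (ex_derive (is_derive := d0))
    (ex_derive (is_derive := d1)).
  by rewrite /difference (derive_val (is_derive := d0))
    (derive_val (is_derive := d1)).
have [c ch ->] := directional_MVT h0 (fun c ch => ex_derive (is_derive := dD c ch)).
have -> := derive_val (is_derive := dD c ch).
have [||a [b [ah bh ->]]] := @second_difference ('D_w g) (x + c *: w) u v h P h0.
- by move=> a b ah bh; exact: Px.
- by move=> y /dg[_ d1 d2]; exact (conj d1 d2).
by exists a, b, c; split=> //; rewrite mulrA -exprS.
Qed.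

End Directional_calculus.

(** * Directional derivatives of functions of class C^k *)

(** Error count for a difference quotient: [p'] and [q'] are mean values near the derivatives [p]
    and [q], and the three errors enter with weights 1, a, b. *)
Lemma dist_comb (R : realFieldType) (a b e l p p' q q' : R) :
  0 <= a -> 0 <= b -> `|l - (a * p' + b * q')| <= e ->
  `|p' - p| <= e -> `|q' - q| <= e -> `|l - (a * p + b * q)| <= e * (1 + a + b).
Proof.
move=> a0 b0 le /(ler_wpM2l a0) + /(ler_wpM2l b0).
rewrite -{1}(ger0_norm a0) -{1}(ger0_norm b0) -!normrM => pe qe.
have -> : l - (a * p + b * q) =
    (l - (a * p' + b * q')) + (a * (p' - p) + b * (q' - q)) by ring.
apply: le_trans (ler_normD _ _) _; have := ler_normD (a * (p' - p)) (b * (q' - q)).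
by lra.
Qed.

Section Class_Ck.
Context {R : realType} {V : normedModType R}.
Implicit Types (g : V -> R^o) (x y u v w : V) (O W : set V) (a b c h : R).

Definition linear_subspace W :=
  W 0 /\ forall a u v, W u -> W v -> W (a *: u + v).

Lemma linear_subspaceZ W a v : linear_subspace W -> W v -> W (a *: v).
Proof. by case=> W0 WD Wv; rewrite -[_ *: _]addr0; exact: WD. Qed.

Lemma linear_subspaceD W u v : linear_subspace W -> W u -> W v -> W (u + v).
Proof. by case=> W0 WD Wu; rewrite -[u]scale1r; exact: WD. Qed.

Lemma linear_subspace_sum W n (c : 'I_n -> R) (w : 'I_n -> V) :
  linear_subspace W -> (forall i, W (w i)) -> W (\sum_i c i *: w i).
Proof.
move=> WL Ww; elim/big_ind: _ => [|u v|i _]; first exact: WL.1.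
  exact: linear_subspaceD.
exact: linear_subspaceZ.
Qed.

Lemma Ck_continuous n O W g : Ck n O W g -> {within O `&` W, continuous g}.
Proof. by case: n => [|n] []. Qed.

Lemma CkW n O W g : Ck n.+1 O W g -> Ck n O W g.
Proof.
elim: n g => [|n IH] g [gc [gd gD]]; first by split.
by split=> //; split=> // v /gD; exact: IH.
Qed.

Lemma Ck_derivable n O W g x v :
  Ck n.+1 O W g -> (O `&` W) x -> W v -> derivable g x v.
Proof. by case=> _ [+ _]; apply. Qed.

Lemma Ck_derive n O W g v : Ck n.+1 O W g -> W v -> Ck n O W ('D_v g).
Proof. by case=> _ [_]; apply. Qed.

Lemma within_continuous_cvg (A : set V) g x :
  {within A, continuous g} -> A x -> g @ within A (nbhs x) --> g x.
Proof.
move=> gc Ax; rewrite (nbhs_subspace_in Ax); exact: gc.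
Qed.

Lemma within_continuousP (A : set V) g x e :
  {within A, continuous g} -> A x -> 0 < e ->
  exists2 d, 0 < d & forall y, A y -> `|y - x| < d -> `|g y - g x| < e.
Proof.
move=> gc Ax e0; have /cvgrPdist_lt/(_ e e0) := within_continuous_cvg gc Ax.
rewrite near_withinE => /nbhs_normP[d /= d0 H]; exists d => // y Ay yx.
by rewrite distrC; apply: H => //=; rewrite /ball_/= distrC.
Qed.

Lemma open_normP O x : open O -> O x ->
  exists2 d, 0 < d & forall y, `|y - x| < d -> O y.
Proof.
move=> oO Ox; have /nbhs_normP[d /= d0 H] := open_nbhs_nbhs (conj oO Ox).
by exists d => // y yx; apply: H; rewrite /= /ball_/= distrC.
Qed.

Lemma near_line O W x v : open O -> linear_subspace W -> (O `&` W) x -> W v ->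
  \forall h \near (0 : R)^', (O `&` W) (h *: v + x).
Proof.
move=> oO WL [Ox Wx] Wv; have [d d0 H] := open_normP oO Ox.
have v1 : 0 < `|v| + 1 by rewrite ltr_wpDl.
have : \forall h \near (0 : R)^', `|h| < d / (`|v| + 1).
  by apply: dnbhs0_lt; rewrite divr_gt0.
apply: filterS => h; rewrite ltr_pdivlMr // => hd; split; last exact: WL.2.
apply: H; rewrite addrK normrZ; apply: le_lt_trans hd.
by rewrite ler_wpM2l // lerDl.
Qed.

(** The difference quotients for small steps only sample points of O lying in W, so values elsewhere
    do not affect the limit. *)
Lemma derive_eq_on O W g1 g2 x v : open O -> linear_subspace W ->
  (forall y, (O `&` W) y -> g1 y = g2 y) -> (O `&` W) x -> W v ->
  'D_v g1 x = 'D_v g2 x.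
Proof.
move=> oO WL g12 Dx Wv; rewrite /derive; congr (lim _).
rewrite eqEsubset; split; apply: near_eq_cvg;
  by apply: filterS (near_line oO WL Dx Wv) => h Dh; rewrite /= g12 // g12.
Qed.

(** [Ck] speaks of directional derivatives only, so additivity in the direction needs a proof. The
    increment along a u + b v is split into a leg along u and a leg along v; the mean value theorem
    handles each leg, and continuity of D_u g and D_v g brings the mean values back to x.
    Nonnegative coefficients make both steps nonnegative. *)
Lemma derive_nonneg_comb O W g x u v a b : open O -> linear_subspace W ->
  Ck 1 O W g -> (O `&` W) x -> W u -> W v -> 0 <= a -> 0 <= b ->
  'D_(a *: u + b *: v) g x = a * 'D_u g x + b * 'D_v g x.
Proof.
move=> oO WL gC [Ox Wx] Wu Wv a0 b0; set w := a *: u + b *: v.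
have Ww : W w by apply: WL.2 => //; exact: linear_subspaceZ.
set L := LHS; set S := RHS; apply/eqP; rewrite -subr_eq0 -normr_le0 leNgt.
(* With this e, [dist_comb] bounds the gap by half of itself. *)
apply/negP => LS0; pose e := `|L - S| / (2 * (1 + a + b)).
have ab0 : 0 < 1 + a + b by rewrite ltr_wpDr // ltr_wpDr.
have e0 : 0 < e by rewrite divr_gt0 // mulr_gt0.
have /cvgrPdist_lt/(_ e e0) := Ck_derivable gC (conj Ox Wx) Ww.
rewrite near_withinE => /nbhs_normP[d /= d0 Hd].
have [du du0 Hu] := within_continuousP
  (Ck_continuous (Ck_derive gC Wu)) (conj Ox Wx) e0.
have [dv dv0 Hv] := within_continuousP
  (Ck_continuous (Ck_derive gC Wv)) (conj Ox Wx) e0.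
have [dO dO0 HO] := open_normP oO Ox.
(* The two legs together have length at most h M, so a small h M keeps all intermediate points
   within the three radii; h < d controls the difference quotient itself. *)
pose M := 1 + a * `|u| + b * `|v|.
have M0 : 0 < M by rewrite !ltr_wpDr // mulr_ge0.
pose h := Num.min d (Num.min du (Num.min dv dO) / M) / 2.
have m0 : 0 < Num.min du (Num.min dv dO) by rewrite !lt_min du0 dv0.
have h0 : 0 < h by rewrite divr_gt0 // lt_min d0 divr_gt0.
have hd : h < d.
  have : h <= d / 2 by rewrite ler_wpM2r // ge_min lexx.
  by lra.
have hM : h * M < Num.min du (Num.min dv dO).
  rewrite -ltr_pdivlMr //.
  have : h <= Num.min du (Num.min dv dO) / M / 2.
    by rewrite ler_wpM2r // ge_min lexx orbT.
  have : 0 < Num.min du (Num.min dv dO) / M by rewrite divr_gt0.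
  by lra.
clearbody h.
have close r s : 0 <= r <= h * a -> 0 <= s <= h * b ->
    `|x + r *: u + s *: v - x| < Num.min du (Num.min dv dO).
  move=> /andP[r0 ra] /andP[s0 sb].
  rewrite -[x + _ + _]addrA [x + _]addrC addrK; apply: le_lt_trans hM.
  apply: le_trans (ler_normD _ _) _; rewrite !normrZ (ger0_norm r0) (ger0_norm s0) /M.
  have := ler_wpM2r (normr_ge0 u) ra; have := ler_wpM2r (normr_ge0 v) sb.
  by move: h0; lra.
have inD r s : 0 <= r <= h * a -> 0 <= s <= h * b ->
    (O `&` W) (x + r *: u + s *: v).
  move=> rI sI; split.
    by apply: HO; have := close r s rI sI; rewrite !lt_min => /and3P[].
  apply: linear_subspaceD => //; last exact: linear_subspaceZ.
  apply: linear_subspaceD => //; exact: linear_subspaceZ.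
have ha0 : 0 <= h * a by rewrite mulr_ge0 // ltW.
have hb0 : 0 <= h * b by rewrite mulr_ge0 // ltW.
have z0 (c : R) : 0 <= c -> 0 <= (0 : R) <= c by rewrite lexx => ->.
have [r rI Er] : exists2 r, 0 <= r <= h * a &
    difference ((h * a) *: u) g x = h * a * 'D_u g (x + r *: u).
  apply: directional_MVT => // r rI; apply: (Ck_derivable gC) => //.
  by have := inD r 0 rI (z0 _ hb0); rewrite scale0r addr0.
have [s sI Es] : exists2 s, 0 <= s <= h * b &
    difference ((h * b) *: v) g (x + (h * a) *: u) =
    h * b * 'D_v g (x + (h * a) *: u + s *: v).
  apply: directional_MVT => // s sI; apply: (Ck_derivable gC) => //.
  by apply: inD; rewrite // ha0 lexx.
have haI : 0 <= h * a <= h * a by rewrite ha0 lexx.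
have Eu : `|'D_u g (x + r *: u) - 'D_u g x| < e.
  apply: Hu; have := inD r 0 rI (z0 _ hb0); have := close r 0 rI (z0 _ hb0);
  by rewrite scale0r addr0 // !lt_min => /andP[].
have Ev : `|'D_v g (x + (h * a) *: u + s *: v) - 'D_v g x| < e.
  apply: Hv; first exact: inD.
  by have := close _ _ haI sI; rewrite !lt_min => /and3P[].
have := Hd h; rewrite /ball_ /= sub0r normrN gtr0_norm // => /(_ hd).
rewrite gt_eqF // -/L => /(_ isT).
have -> : g (h *: w + x) - g x = h * (a * 'D_u g (x + r *: u) +
    b * 'D_v g (x + (h * a) *: u + s *: v)).
  have -> : h *: w + x = x + (h * a) *: u + (h * b) *: v.
    by rewrite /w scalerDr !scalerA addrC addrA.
  rewrite -[LHS](subrKA (g (x + (h * a) *: u))) -/(difference _ g _).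
  rewrite Es -/(difference _ g x) Er -!mulrA -mulrDr; congr (h * _).
  exact: addrC.
rewrite -[_ *: _]/(_ * _) mulKf ?gt_eqF // => EL.
have Ee : e * (1 + a + b) = `|L - S| / 2 by rewrite /e; field; rewrite gt_eqF.
have := dist_comb a0 b0 (ltW EL) (ltW Eu) (ltW Ev); rewrite Ee leNgt => /negP; apply.
by rewrite ltr_pdivrMr // mulr_natr mulr2n ltrDl.
Qed.

(** Signs move from the coefficients into the directions by D_(-y) g = - D_y g, which is the
    nonnegative case applied to y + (-y) = 0. *)
Lemma derive_comb O W g x u v a b : open O -> linear_subspace W ->
  Ck 1 O W g -> (O `&` W) x -> W u -> W v ->
  'D_(a *: u + b *: v) g x = a * 'D_u g x + b * 'D_v g x.
Proof.
move=> oO WL gC Dx Wu Wv.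
have WN y : W y -> W (- y) by rewrite -scaleN1r; exact: linear_subspaceZ.
have DN y : W y -> 'D_(- y) g x = - 'D_y g x.
  move=> Wy; have := derive_nonneg_comb oO WL gC Dx Wy (WN _ Wy) ler01 ler01.
  by rewrite !scale1r subrr derive0 !mul1r => /eqP; rewrite eq_sym addrC addr_eq0 => /eqP.
wlog : a u Wu / 0 <= a.
  move=> H; have [/H|a0] := leP 0 a; first exact.
  rewrite -[a]opprK scaleNr -scalerN H ?DN //; [ring | exact: WN |].
  by rewrite oppr_ge0 ltW.
move=> a0; have [b0|b0] := leP 0 b; first exact: (derive_nonneg_comb oO WL).
rewrite -[b]opprK scaleNr -[- (_ *: v)]scalerN (derive_nonneg_comb oO WL) ?DN //.
- by ring.
- exact: WN.
- by rewrite oppr_ge0 ltW.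
Qed.

Lemma deriveZv O W g x v a : open O -> linear_subspace W ->
  Ck 1 O W g -> (O `&` W) x -> W v -> 'D_(a *: v) g x = a * 'D_v g x.
Proof.
move=> oO WL gC Dx Wv; have := derive_comb a 0 oO WL gC Dx Wv Wv.
by rewrite scale0r addr0 mul0r addr0.
Qed.

Lemma derive_sumv O W g x n (c : 'I_n -> R) (w : 'I_n -> V) :
  open O -> linear_subspace W -> Ck 1 O W g -> (O `&` W) x ->
  (forall i, W (w i)) ->
  'D_(\sum_i c i *: w i) g x = \sum_i c i * 'D_(w i) g x.
Proof.
move=> oO WL gC Dx Ww.
suff : W (\sum_i c i *: w i) /\
    'D_(\sum_i c i *: w i) g x = \sum_i c i * 'D_(w i) g x by case.
elim/big_rec2: _ => [|i y1 y2 _ [Wy Ey]]; first by split; [exact: WL.1|exact: derive0].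
split; first exact: WL.2.
by rewrite -[y2]scale1r (derive_comb _ _ oO WL) // Ey mul1r.
Qed.

Lemma derive_sumf (n : nat) (c : 'I_n -> R) (g : 'I_n -> V -> R^o) x v :
  (forall i, derivable (g i) x v) ->
  'D_v (fun y => \sum_i c i * g i y : R^o) x = \sum_i c i * 'D_v (g i) x.
Proof.
move=> dg; have -> : (fun y => \sum_i c i * g i y : R^o) = \sum_i (c i *: g i).
  by apply/funext => y; rewrite fct_sumE.
rewrite derive_sum => [|i]; last exact: derivableZ.
by apply: eq_bigr => i _; rewrite deriveZ.
Qed.

Lemma derive2_sumv O W g x n (c : 'I_n -> R) (w : 'I_n -> V) :
  open O -> linear_subspace W -> Ck 2 O W g -> (O `&` W) x ->
  (forall i, W (w i)) -> let z := \sum_i c i *: w i in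
  'D_z ('D_z g) x = \sum_i c i * \sum_j c j * 'D_(w j) ('D_(w i) g) x.
Proof.
move=> oO WL gC Dx Ww z; have Wz : W z by exact: linear_subspace_sum.
transitivity ('D_z (fun y => \sum_i c i * 'D_(w i) g y : R^o) x).
  (* The inner derivative has to be expanded at all points of O in W, since the outer one
     differentiates it. *)
  apply: (derive_eq_on oO WL) => // y Dy.
  by rewrite (derive_sumv _ oO WL) //; exact: CkW.
rewrite derive_sumf => [|i]; last first.
  by apply: (Ck_derivable _ Dx Wz); exact: (Ck_derive gC).
apply: eq_bigr => i _; rewrite (derive_sumv _ oO WL) //.
exact: (Ck_derive gC).
Qed.

Lemma derive3_sumv O W g x u n (c : 'I_n -> R) (w : 'I_n -> V) :
  open O -> linear_subspace W -> Ck 3 O W g -> (O `&` W) x -> W u ->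
  (forall i, W (w i)) -> let z := \sum_i c i *: w i in
  'D_u ('D_z ('D_z g)) x =
  \sum_i c i * \sum_j c j * 'D_u ('D_(w j) ('D_(w i) g)) x.
Proof.
move=> oO WL gC Dx Wu Ww z; have Wz : W z by exact: linear_subspace_sum.
have dg i j y : (O `&` W) y -> derivable ('D_(w j) ('D_(w i) g)) y u.
  move=> Dy; apply: (Ck_derivable _ Dy Wu).
  by apply: Ck_derive (Ww j); exact: Ck_derive gC (Ww i).
transitivity ('D_u (fun y => \sum_i c i *
    (\sum_j c j * 'D_(w j) ('D_(w i) g) y : R^o) : R^o) x).
  apply: (derive_eq_on oO WL) => // y Dy.
  by rewrite (derive2_sumv _ oO WL) //; exact: CkW.
rewrite derive_sumf => [|i]; last first.
  have -> : (fun y => \sum_j c j * 'D_(w j) ('D_(w i) g) y : R^o) =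
      \sum_j (c j *: 'D_(w j) ('D_(w i) g)).
    by apply/funext => y; rewrite fct_sumE.
  by apply: derivable_sum => j; apply: derivableZ; exact: dg.
apply: eq_bigr => i _; rewrite derive_sumf // => j; exact: dg.
Qed.

Lemma differenceC (u v x : V) g :
  difference u (difference v g) x = difference v (difference u g) x.
Proof. by rewrite /difference [x + u + v]addrAC; lra. Qed.

(** Schwarz: the second difference is symmetric in u and v, and it is h^2 times either mixed
    derivative at some point near x. Cancelling h^2 and using continuity of both at x rules out a
    positive gap e. *)
Lemma derive_comm O W g x u v : open O -> linear_subspace W ->
  Ck 2 O W g -> (O `&` W) x -> W u -> W v ->
  'D_u ('D_v g) x = 'D_v ('D_u g) x.
Proof.
move=> oO WL gC [Ox Wx] Wu Wv; apply/eqP; rewrite -subr_eq0 -normr_le0 leNgt.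
apply/negP => e0; set e := `|_| in e0.
have e20 : 0 < e / 2 by rewrite divr_gt0.
have C0 u' v' : W u' -> W v' -> {within O `&` W, continuous ('D_u' ('D_v' g))}.
  by move=> Wu' Wv'; exact: Ck_continuous (Ck_derive (Ck_derive gC Wv') Wu').
have [d1 d10 H1] := within_continuousP (C0 _ _ Wu Wv) (conj Ox Wx) e20.
have [d2 d20 H2] := within_continuousP (C0 _ _ Wv Wu) (conj Ox Wx) e20.
have [dO dO0 HO] := open_normP oO Ox.
pose d := Num.min d1 (Num.min d2 dO).
have d0 : 0 < d by rewrite !lt_min d10 d20.
pose h := d / (1 + `|u| + `|v|) / 2.
have M0 : 0 < 1 + `|u| + `|v| by rewrite !ltr_wpDr.
have h0 : 0 < h by rewrite !divr_gt0.
have hM : h * (`|u| + `|v|) < d.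
  have : h * (1 + `|u| + `|v|) = d / 2 by rewrite /h; field; rewrite gt_eqF.
  by lra.
have close (u' v' : V) a b : `|u'| + `|v'| = `|u| + `|v| ->
    0 <= a <= h -> 0 <= b <= h -> `|x + b *: v' + a *: u' - x| < d.
  move=> E /andP[a0 ah] /andP[b0 bh]; rewrite -[x + _ + _]addrA [x + _]addrC addrK.
  apply: le_lt_trans hM; apply: le_trans (ler_normD _ _) _; rewrite -E.
  rewrite !normrZ (ger0_norm a0) (ger0_norm b0) mulrDr addrC.
  by rewrite lerD // ler_wpM2r.
have inD (u' v' : V) a b : `|u'| + `|v'| = `|u| + `|v| -> W u' -> W v' ->
    0 <= a <= h -> 0 <= b <= h -> (O `&` W) (x + b *: v' + a *: u').
  move=> E Wu' Wv' aI bI; split.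
    by apply: HO; have := close _ _ _ _ E aI bI; rewrite !lt_min => /and3P[].
  apply: linear_subspaceD => //; last exact: linear_subspaceZ.
  by apply: linear_subspaceD => //; exact: linear_subspaceZ.
have dd u' v' : W u' -> W v' -> forall y, (O `&` W) y ->
    derivable g y v' /\ derivable ('D_v' g) y u'.
  move=> Wu' Wv' y Dy; split; first exact: (Ck_derivable gC).
  exact: (Ck_derivable (Ck_derive gC Wv')).
have [a1 [b1 [a1I b1I E1]]] := second_difference (ltW h0)
  (fun a b => inD u v a b erefl Wu Wv) (dd _ _ Wu Wv).
have vu := addrC `|v| `|u|.
have [a2 [b2 [a2I b2I E2]]] := second_difference (ltW h0)
  (fun a b => inD v u a b vu Wv Wu) (dd _ _ Wv Wu).
have E : 'D_u ('D_v g) (x + b1 *: v + a1 *: u) =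
    'D_v ('D_u g) (x + b2 *: u + a2 *: v).
  have h20 : h ^+ 2 != 0 by rewrite expf_neq0 // gt_eqF.
  exact (mulfI h20 (etrans (esym E1) (etrans (differenceC _ _ _ _) E2))).
have := H1 _ (inD _ _ _ _ erefl Wu Wv a1I b1I).
have := H2 _ (inD _ _ _ _ vu Wv Wu a2I b2I).
have := close _ _ _ _ vu a2I b2I; have := close _ _ _ _ (erefl _) a1I b1I.
rewrite !lt_min => /and3P[c1 _ _] /and3P[_ c2 _] /(_ c2) + /(_ c1).
rewrite E /e; generalize ('D_v ('D_u g) (x + b2 *: u + a2 *: v)).
generalize ('D_v ('D_u g) x), ('D_u ('D_v g) x) => p q r rp rq.
have := ler_normD (q - r) (r - p); rewrite addrA subrK [`|q - r|]distrC => H.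
have := ltrD rp rq; rewrite -splitr addrC => /(le_lt_trans H).
by rewrite ltxx.
Qed.

End Class_Ck.

(** * Minkowski space *)

Section Minkowski_space.
Context {R : realType}.
Implicit Types (p : 'rV[R]_4) (t v : 'cV[R]_4) (S T : 'M[R]_4) (k : R * R * R).

Lemma sum4E (F : 'I_4 -> R) :
  \sum_i F i = F 0 + F 1 + F (inord 2) + F (inord 3).
Proof.
rewrite !big_ord_recr big_ord0 /= add0r.
by congr (F _ + F _ + F _ + F _); apply/val_inj; rewrite /= ?inordK.
Qed.

Lemma eta_mulE v a : (Defs.eta *m v) a 0 = (if a == 0 then -1 else 1) * v a 0.
Proof. by rewrite mul_diag_mx !mxE. Qed.

Lemma future_timelikeE v : future_timelike v <->
  v 1 0 ^+ 2 + v (inord 2) 0 ^+ 2 + v (inord 3) 0 ^+ 2 < v 0 0 ^+ 2 /\ 0 < v 0 0.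
Proof.
have e2 : (inord 2 == 0 :> 'I_4) = false by rewrite -val_eqE /= inordK.
have e3 : (inord 3 == 0 :> 'I_4) = false by rewrite -val_eqE /= inordK.
rewrite /future_timelike -mulmxA mxE sum4E !eta_mulE eqxx e2 e3 !mxE /=.
set A := (X in X < 0); have -> : A = - v 0 0 ^+ 2 +
  (v 1 0 ^+ 2 + v (inord 2) 0 ^+ 2 + v (inord 3) 0 ^+ 2) by rewrite /A; ring.
by rewrite addrC subr_lt0.
Qed.

Lemma energy_gt0 (m : R) k : 0 < m -> 0 < energy m k.
Proof.
by move=> m0; rewrite sqrtr_gt0 ltr_pwDl ?exprn_gt0 // !addr_ge0 ?sqr_ge0.
Qed.

Lemma pairing_shellE (m : R) k v : pairing (shell_point m k) v =
  - energy m k * v 0 0 + k.1.1 * v 1 0 + k.1.2 * v (inord 2) 0 + k.2 * v (inord 3) 0.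
Proof. by rewrite /pairing mxE sum4E !mxE /= !inordK. Qed.

(** Cauchy-Schwarz on the spatial parts; the inequality is strict even for null v because m > 0
    makes the energy exceed the length of k. *)
Lemma pairing_shell_lt0 (m : R) k v : 0 < m -> 0 < v 0 0 ->
  v 1 0 ^+ 2 + v (inord 2) 0 ^+ 2 + v (inord 3) 0 ^+ 2 <= v 0 0 ^+ 2 ->
  pairing (shell_point m k) v < 0.
Proof.
move=> m0; rewrite pairing_shellE.
have E0 := energy_gt0 k m0.
have E2 : energy m k ^+ 2 = m ^+ 2 + (k.1.1 ^+ 2 + k.1.2 ^+ 2 + k.2 ^+ 2).
  by rewrite sqr_sqrtr // !addr_ge0 ?sqr_ge0.
move: (energy m k) (v 0 0) (v 1 0) (v (inord 2) 0) (v (inord 3) 0) k.1.1 k.1.2 k.2 E0 E2.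
move=> e t x y z a b c e0 e2 t0 xyz.
have et : 0 < e * t by exact: mulr_gt0.
suff : a * x + b * y + c * z < e * t by lra.
rewrite ltNge; apply/negP => H.
have : (e * t) ^+ 2 <= (a * x + b * y + c * z) ^+ 2.
  by rewrite ler_sqr // nnegrE ?ltW //; apply: lt_le_trans et H.
(* By Lagrange's identity the gap is the sum of the three squared minors. *)
have : (a * x + b * y + c * z) ^+ 2 <=
    (a ^+ 2 + b ^+ 2 + c ^+ 2) * (x ^+ 2 + y ^+ 2 + z ^+ 2).
  have := sqr_ge0 (a * y - b * x); have := sqr_ge0 (a * z - c * x).
  by have := sqr_ge0 (b * z - c * y); lra.
have : (a ^+ 2 + b ^+ 2 + c ^+ 2) * (x ^+ 2 + y ^+ 2 + z ^+ 2) <=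
    (a ^+ 2 + b ^+ 2 + c ^+ 2) * t ^+ 2.
  by rewrite ler_wpM2l // !addr_ge0 ?sqr_ge0.
have : 0 < m ^+ 2 * t ^+ 2 by rewrite mulr_gt0 // exprn_gt0.
by rewrite exprMn e2; lra.
Qed.

Lemma quadE p T : quad p T = \sum_i \sum_j p 0 i * p 0 j * T i j.
Proof.
rewrite /quad -mulmxA mxE; apply: eq_bigr => i _; rewrite mxE mulr_sumr.
by apply: eq_bigr => j _; rewrite !mxE; ring.
Qed.

Lemma quadD p S T : quad p (S + T) = quad p S + quad p T.
Proof. by rewrite /quad mulmxDr mulmxDl mxE. Qed.

Lemma quadZ p (a : R) T : quad p (a *: T) = a * quad p T.
Proof. by rewrite /quad -scalemxAr -scalemxAl mxE. Qed.

Lemma pairingD p t v : pairing p (t + v) = pairing p t + pairing p v.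
Proof. by rewrite /pairing mulmxDr mxE. Qed.

Lemma pairingZ p (a : R) v : pairing p (a *: v) = a * pairing p v.
Proof. by rewrite /pairing -scalemxAr mxE. Qed.

(** Each |p_i p_j| is at most the Euclidean square norm of p. The frame norm is used because it
    bounds [quad] on all covectors. *)
Lemma quad_le p T :
  quad p T <= (\sum_i \sum_j `|T i j|) * \sum_i p 0 i ^+ 2.
Proof.
rewrite quadE mulr_suml; apply: ler_sum => i _; rewrite mulr_suml.
apply: ler_sum => j _; apply: le_trans (ler_norm _) _.
rewrite normrM mulrC ler_wpM2l //.
have le1 l : p 0 l ^+ 2 <= \sum_i p 0 i ^+ 2.
  by rewrite (bigD1 l) //= lerDl sumr_ge0 // => i' _; exact: sqr_ge0.
have := le1 i; have := le1 j; rewrite -(real_normK (num_real (p 0 i))).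
rewrite -(real_normK (num_real (p 0 j))) normrM.
by have := sqr_ge0 (`|p 0 i| - `|p 0 j|); lra.
Qed.

Lemma sym_tracefree0 : sym_tracefree (0 : 'M[R]_4).
Proof. by split; rewrite ?trmx0 ?mulmx0 ?mxtrace0. Qed.

Lemma sym_tracefree_comb (a : R) S T :
  sym_tracefree S -> sym_tracefree T -> sym_tracefree (a *: S + T).
Proof.
case=> S1 S2 [T1 T2]; split; first by rewrite raddfD /= linearZ /= S1 T1.
by rewrite mulmxDr -scalemxAr mxtraceD mxtraceZ S2 T2 mulr0 addr0.
Qed.

(* An interior point of C^-: small perturbations of it are nonpositive on all
   covectors, not only on null ones. *)
Definition cone_center : 'M[R]_4 :=
  diag_mx (\row_a (if a == 0 then - 3 else - 1)).

Lemma cone_center_sym_tracefree : sym_tracefree cone_center.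
Proof.
split; first exact: tr_diag_mx.
have e2 : (inord 2 == 0 :> 'I_4) = false by rewrite -val_eqE /= inordK.
have e3 : (inord 3 == 0 :> 'I_4) = false by rewrite -val_eqE /= inordK.
rewrite /mxtrace sum4E !mul_diag_mx !mxE !eqxx e2 e3 /=.
by rewrite !mulr1n; ring.
Qed.

Lemma quad_cone_center p : quad p cone_center <= - \sum_i p 0 i ^+ 2.
Proof.
rewrite quadE -sumrN; apply: ler_sum => i _.
rewrite (bigD1 i) //= big1 ?addr0 => [|j ji]; last first.
  by rewrite !mxE [i == j]eq_sym (negbTE ji) mulr0n mulr0.
rewrite !mxE eqxx mulr1n; have := sqr_ge0 (p 0 i).
by case: ifP => _; rewrite expr2; lra.
Qed.

(** With K the entry sum and P the Euclidean square norm of p, the first term is at most - 2 d K P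
    and the second at most r K P. The range up to 2 d allows for two steps along the same
    perturbation. *)
Lemma cone_perturbation p T (d r : R) : 0 <= d -> 0 <= r <= 2 * d ->
  quad p ((d * (2 * (\sum_i \sum_j `|T i j|))) *: cone_center + r *: T) <= 0.
Proof.
move=> d0 /andP[r0 rd]; rewrite quadD !quadZ.
have S0 : 0 <= \sum_i p 0 i ^+ 2 by apply: sumr_ge0 => i _; exact: sqr_ge0.
have K0 : 0 <= \sum_i \sum_j `|T i j|.
  by apply: sumr_ge0 => i _; apply: sumr_ge0.
have := ler_wpM2l r0 (quad_le p T).
have := quad_cone_center p; move: (\sum_i p 0 i ^+ 2) S0 => P P0.
move: (\sum_i _) K0 => K K0.
have dK : 0 <= d * (2 * K) by rewrite !mulr_ge0.
move=> /(ler_wpM2l dK) H1 H2.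
have : r * (K * P) <= 2 * d * (K * P) by rewrite ler_wpM2r // mulr_ge0.
by move: H1 H2; lra.
Qed.

End Minkowski_space.

(** * Third differences of the integrand *)

Section Third_derivative.
Context {R : realType}.
Implicit Types (p : 'rV[R]_4) (t : 'cV[R]_4) (s Z : fields R).

Lemma linear_subspaceT (V : normedModType R) : linear_subspace [set: V].
Proof. by []. Qed.

Lemma open_quadrant : open (@quadrant R).
Proof.
apply: openI; apply: open_comp (@open_lt R 0) => z _; [exact: cvg_fst|exact: cvg_snd].
Qed.

(** For fixed p this argument of f is linear in the state, so differences in the state become
    differences of f. *)
Definition shell_arg p s : R^o * R^o :=
  (s.1.1 + quad p s.2, pairing p s.1.2).

Lemma shell_argD p s Z : shell_arg p (s + Z) = shell_arg p s + shell_arg p Z.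
Proof. by rewrite /shell_arg /= quadD pairingD addrACA. Qed.

Lemma shell_argZ p (a : R) Z : shell_arg p (a *: Z) = a *: shell_arg p Z.
Proof. by rewrite /shell_arg /= quadZ pairingZ; congr pair; rewrite -mulrDr. Qed.

(** The outer direction is (0, c) because a change of zeta^a alone moves only y. Expanding (a, b) in
    the two axes gives four third derivatives. *)
Lemma derive3_quadrant (f : R^o * R^o -> R) (z : R^o * R^o) (a b c : R) :
  Ck 3 (@quadrant R) setT f -> quadrant z ->
  'D_((0, c) : R^o * R^o) ('D_((a, b) : R^o * R^o)
    ('D_((a, b) : R^o * R^o) (f : _ -> R^o))) z =
  c * (dy (dx (dx f)) z * a ^+ 2 + 2 * dy (dy (dx f)) z * a * b +
       dy (dy (dy f)) z * b ^+ 2).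
Proof.
move=> fC qz; have oQ := open_quadrant.
have LT := linear_subspaceT (R^o * R^o)%type.
have Dz : (@quadrant R `&` setT) z by [].
pose e (i : 'I_2) : R^o * R^o := if i == 0 then (1, 0) else (0, 1).
pose d (i : 'I_2) : R := if i == 0 then a else b.
have sum2 (F : 'I_2 -> R) : \sum_i F i = F ord0 + F (lift ord0 ord0).
  by rewrite !big_ord_recl big_ord0 addr0.
set u : R^o * R^o := (1, 0); set v : R^o * R^o := (0, 1).
have -> : (a, b) = \sum_i d i *: e i :> R^o * R^o.
  rewrite !big_ord_recl big_ord0 /d /e /= addr0.
  by congr pair; rewrite /= scaler0 ?addr0 ?add0r; exact: esym (mulr1 _).
have D3 := @derive3_sumv _ _ _ _ _ z (0, c) 2 d e oQ LT fC Dz I (fun=> I).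
have {}D3 := etrans D3 (etrans (sum2 _)
  (f_equal2 +%R (f_equal2 *%R erefl (sum2 _)) (f_equal2 *%R erefl (sum2 _)))).
apply: (etrans D3) => {D3}.
rewrite -[d ord0]/a -[d (lift _ _)]/b -[e ord0]/u -[e (lift _ _)]/v.
have Z3 w w' : 'D_((0, c) : R^o * R^o) ('D_w ('D_w' (f : _ -> R^o))) z =
    c * 'D_v ('D_w ('D_w' (f : _ -> R^o))) z.
  have -> : (0, c) = c *: v.
    by congr pair; [exact: esym (mulr0 _)|exact: esym (mulr1 _)].
  by apply: (deriveZv _ oQ LT _ Dz) => //; apply: Ck_derive => //; exact: Ck_derive.
(* This cross term is the only one whose order of derivatives differs from the form in the
   statement. *)
have vuv : 'D_v ('D_u ('D_v (f : _ -> R^o))) z = 'D_v ('D_v ('D_u (f : _ -> R^o))) z.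
  exact (derive_eq_on oQ LT
    (fun y Dy => derive_comm oQ LT (CkW fC) Dy (I : setT u) (I : setT v)) Dz I).
have alg (x1 x2 x3 x4 y1 y2 y3 y4 : R) : y3 = y2 -> x1 = c * y1 -> x2 = c * y2 ->
    x3 = c * y3 -> x4 = c * y4 -> a * (a * x1 + b * x2) + b * (a * x3 + b * x4) =
    c * (y1 * a ^+ 2 + 2 * y2 * a * b + y4 * b ^+ 2).
  by move=> -> -> -> -> ->; ring.
exact (alg _ _ _ _ _ _ _ _ vuv (Z3 u u) (Z3 v u) (Z3 u v) (Z3 v v)).
Qed.

(** A perturbation of zeta^a alone, along any spacetime vector; for basis vectors it is the outer
    direction in [mform]. *)
Definition spatial t : fields R := (0, t, 0).

(** By linearity of [shell_arg p] this is a third difference of f on the quadrant, evaluated by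
    [derive3_quadrant] with c = p_a t^a. *)
Lemma integrand_third_difference (f : R^o * R^o -> R) p t s Z (h : R) :
  Ck 3 (@quadrant R) setT f -> 0 <= h ->
  (forall a b c, 0 <= a <= h -> 0 <= b <= h -> 0 <= c <= h ->
    quadrant (shell_arg p (s + c *: Z + b *: Z + a *: spatial t))) ->
  exists a b c, [/\ 0 <= a <= h, 0 <= b <= h, 0 <= c <= h &
    difference (h *: Z) (difference (h *: Z) (difference (h *: spatial t)
      (fun s => integrand f s p))) s =
    h ^+ 3 * (pairing p t *
      causality_integrand f (s + c *: Z + b *: Z + a *: spatial t) Z p)].
Proof.
move=> fC h0 Q.
have Lt : shell_arg p (spatial t) = (0, pairing p t).
  by rewrite /shell_arg /= /quad mulmx0 mul0mx mxE addr0.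
have LE a b c : shell_arg p (s + c *: Z + b *: Z + a *: spatial t) =
    shell_arg p s + c *: shell_arg p Z + b *: shell_arg p Z +
      a *: ((0, pairing p t) : R^o * R^o).
  by rewrite !shell_argD !shell_argZ Lt.
have [|y qy|a [b [c [aI bI cI]]]] := @third_difference R _ f (shell_arg p s)
  (0, pairing p t) (shell_arg p Z) (shell_arg p Z) h (@quadrant R) h0.
- by move=> a b c aI bI cI; rewrite -LE; exact: Q.
- have Dy : (@quadrant R `&` setT) y by [].
  split.
  + exact: (Ck_derivable fC Dy).
  + by apply: (Ck_derivable _ Dy); [exact: Ck_derive fC _|].
  + by apply: (Ck_derivable _ Dy); [apply: Ck_derive; [exact: Ck_derive fC _|]|].
rewrite -LE derive3_quadrant //; last exact: Q.
move=> E; exists a, b, c; split=> //.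
rewrite -[causality_integrand _ _ _ _]/(dy (dx (dx f)) _ * _ ^+ 2 + _ + _) -E.
rewrite /difference /integrand.
by rewrite -!/(shell_arg p _) !shell_argD !shell_argZ Lt.
Qed.

End Third_derivative.

(** * Integration over the mass shell *)

Lemma Rintegral_ge (R : realType) (d : measure_display) (T : measurableType d)
    (mu : {measure set T -> \bar R}) (h : T -> R) (B : set T) (c r : R) :
  mu.-integrable setT (EFin \o h) -> measurable B -> mu B = r%:E -> 0 <= c ->
  (forall x, 0 <= h x) -> (forall x, B x -> c <= h x) ->
  c * r <= \int[mu]_x h x.
Proof.
move=> ih mB Br c0 h0 hc; rewrite -lee_fin /Rintegral fineK.
- have mh := measurable_int _ ih.
  apply: (@le_trans _ _ (\int[mu]_(x in B) (h x)%:E)%E).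
    rewrite EFinM -Br -integral_cst //.
    apply: ge0_le_integral => [//|x _|||x Bx]; rewrite ?lee_fin ?hc //.
    exact: measurable_funS mh.
  by apply: ge0_subset_integral => // x _; rewrite lee_fin.
- exact: integrable_fin_num ih.
Qed.

Section Shell_integral.
Context {R : realType}.
Variable m : R.
Implicit Types (g : 'rV[R]_4 -> R) (s d : fields R) (k : R * R * R).

Lemma shell_integralB g1 g2 : shell_integrable m g1 -> shell_integrable m g2 ->
  shell_integrable m (fun p => g1 p - g2 p) /\
  shell_integral m (fun p => g1 p - g2 p) =
    shell_integral m g1 - shell_integral m g2.
Proof.
move=> i1 i2; split.
  have := integrableB measurableT i1 i2; rewrite /shell_integrable.
  by congr (_.-integrable _ _); apply/funext => k /=; rewrite mulrBl.
rewrite /shell_integral -RintegralB //.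
by apply: eq_Rintegral => k _ /=; rewrite mulrBl.
Qed.

Lemma shell_integralN g : shell_integrable m g ->
  shell_integrable m (fun p => - g p) /\
  shell_integral m (fun p => - g p) = - shell_integral m g.
Proof.
move=> ig; split.
  have := integrableN ig; rewrite /shell_integrable.
  by congr (_.-integrable _ _); apply/funext => k /=; rewrite mulNr.
rewrite /shell_integral -mulN1r -RintegralZl //.
by apply: eq_Rintegral => k _ /=; rewrite mulN1r mulNr.
Qed.

(** Integrability is bundled with the equality so that the property passes to iterated
    differences. *)
Definition represented_at (chi : fields R -> R) (J : 'rV[R]_4 -> fields R -> R) s :=
  shell_integrable m (J^~ s) /\ chi s = shell_integral m (J^~ s).

Lemma represented_difference chi J s d :
  represented_at chi J s -> represented_at chi J (s + d) ->
  represented_at (difference d chi) (fun p => difference d (J p)) s.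
Proof.
move=> [i1 e1] [i2 e2]; have [i3 e3] := shell_integralB i2 i1.
by split=> //; rewrite /difference e1 e2 -e3.
Qed.

Lemma shell_integral_ge g
    (B : set (measurableTypeR R * measurableTypeR R * measurableTypeR R)) (c r : R) :
  shell_integrable m g -> measurable B -> @lebesgue3 R B = r%:E -> 0 <= c ->
  (forall k, 0 <= g (shell_point m k) / energy m k) ->
  (forall k, B k -> c <= g (shell_point m k) / energy m k) ->
  c * r <= shell_integral m g.
Proof. exact: Rintegral_ge. Qed.

Lemma lebesgue3_box k (d : R) : 0 < d ->
  let B : set (measurableTypeR R * measurableTypeR R * measurableTypeR R) :=
    ((`]k.1.1 - d, k.1.1 + d[%classic) `*` (`]k.1.2 - d, k.1.2 + d[%classic)) `*`
    (`]k.2 - d, k.2 + d[%classic) in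
  measurable B /\ @lebesgue3 R B = ((2 * d) ^+ 3)%:E.
Proof.
move=> d0 B; split.
  by apply: measurableX; [apply: measurableX|]; exact: measurable_itv.
apply: etrans (product_measure1E _ _ _ _) _.
- by apply: measurableX; exact: measurable_itv.
- exact: measurable_itv.
rewrite /= product_measure1E; [|exact: measurable_itv|exact: measurable_itv].
have itvE (x : R) : (@lebesgue_measure R `]x - d, x + d[ = (2 * d)%:E)%classic.
  rewrite lebesgue_measure_itv /= lte_fin ifT; last by lra.
  by rewrite -EFinB; congr (_%:E); ring.
apply: etrans (congr2 mule (congr2 mule (itvE _) (itvE _)) (itvE _)) _.
by rewrite -!EFinM; congr (_%:E); ring.
Qed.

End Shell_integral.

(** * Continuity and sign of the integrand *)

Section Continuity.
Context {R : realType}.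
Implicit Types (p : 'rV[R]_4) (t : 'cV[R]_4) (s Z : fields R) (k : R * R * R).

Lemma sum_cvg (V : normedModType R) (X : Type) (F : set_system X) n
    (u : 'I_n -> X -> V) (l : 'I_n -> V) : Filter F ->
  (forall i, u i x @[x --> F] --> l i) ->
  \sum_i u i x @[x --> F] --> \sum_i l i.
Proof.
move=> FF ul; apply: cvg_big => //; exact: add_continuous.
Qed.

Lemma pairing_cvg (X : Type) (F : set_system X) (P : X -> 'rV[R]_4)
    (T : X -> 'cV[R]_4) p0 (t0 : 'cV[R]_4) : Filter F ->
  (forall i, P x 0 i @[x --> F] --> p0 0 i) ->
  (forall i, T x i 0 @[x --> F] --> t0 i 0) ->
  pairing (P x) (T x) @[x --> F] --> pairing p0 t0.
Proof.
move=> FF Pp Tt; rewrite /pairing.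
under eq_fun do rewrite mxE; rewrite mxE.
by apply: sum_cvg => i; apply: cvgM.
Qed.

Lemma quad_cvg (X : Type) (F : set_system X) (P : X -> 'rV[R]_4)
    (T : X -> 'M[R]_4) p0 (T0 : 'M[R]_4) : Filter F ->
  (forall i, P x 0 i @[x --> F] --> p0 0 i) ->
  (forall i j, T x i j @[x --> F] --> T0 i j) ->
  quad (P x) (T x) @[x --> F] --> quad p0 T0.
Proof.
move=> FF Pp Tt; under eq_fun do rewrite quadE; rewrite quadE.
by apply: sum_cvg => i; apply: sum_cvg => j; apply: cvgM => //; apply: cvgM.
Qed.

Lemma energy_cvg (X : Type) (F : set_system X) (m : R) (K : X -> R * R * R) k0 :
  Filter F -> K x @[x --> F] --> k0 ->
  energy m (K x) @[x --> F] --> energy m k0.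
Proof.
move=> FF Kk.
have K12 : (K x).1 @[x --> F] --> k0.1 by apply: cvg_comp Kk _; exact: cvg_fst.
have K3 : (K x).2 @[x --> F] --> k0.2 by apply: cvg_comp Kk _; exact: cvg_snd.
have K1 : (K x).1.1 @[x --> F] --> k0.1.1 by apply: cvg_comp K12 _; exact: cvg_fst.
have K2 : (K x).1.2 @[x --> F] --> k0.1.2 by apply: cvg_comp K12 _; exact: cvg_snd.
apply: (@cvg_comp _ _ _ (fun x => m ^+ 2 +
  ((K x).1.1 ^+ 2 + (K x).1.2 ^+ 2 + (K x).2 ^+ 2)) Num.sqrt);
  last exact: sqrt_continuous.
apply: cvgD; first exact: cvg_cst.
by apply: cvgD; [apply: cvgD|]; rewrite expr2; under eq_fun do rewrite expr2;
  exact: cvgM.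
Qed.

Lemma shell_point_cvg (X : Type) (F : set_system X) (m : R) (K : X -> R * R * R) k0 i :
  Filter F -> K x @[x --> F] --> k0 ->
  shell_point m (K x) 0 i @[x --> F] --> shell_point m k0 0 i.
Proof.
move=> FF Kk.
have K12 : (K x).1 @[x --> F] --> k0.1 by apply: cvg_comp Kk _; exact: cvg_fst.
have K3 : (K x).2 @[x --> F] --> k0.2 by apply: cvg_comp Kk _; exact: cvg_snd.
have K1 : (K x).1.1 @[x --> F] --> k0.1.1 by apply: cvg_comp K12 _; exact: cvg_fst.
have K2 : (K x).1.2 @[x --> F] --> k0.1.2 by apply: cvg_comp K12 _; exact: cvg_snd.
under eq_fun do rewrite mxE; rewrite mxE.
case: i => [[|[|[|[|//]]]]] i //=.
by apply: cvgN; exact: energy_cvg.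
Qed.

Lemma quadrant_cvg (X : Type) (F : set_system X) (g : R^o * R^o -> R^o)
    (z : X -> R^o * R^o) z0 : Filter F ->
  {within (@quadrant R) `&` setT, continuous g} -> quadrant z0 ->
  z x @[x --> F] --> z0 -> g (z x) @[x --> F] --> g z0.
Proof.
move=> FF gc qz0 zz; apply: cvg_comp zz _.
have := within_continuous_cvg gc (conj qz0 I); rewrite within_interior // setIT.
by move: (@open_quadrant R); rewrite openE; exact.
Qed.

(** Joint continuity in state and momentum, so that positivity at one point spreads to nearby states
    and a box of momenta at once. *)
Lemma causality_integrand_cvg (X : Type) (F : set_system X)
    (f : R^o * R^o -> R) (m : R) Z (S : X -> fields R) (K : X -> R * R * R) s0 k0 :
  Filter F -> Ck 3 (@quadrant R) setT f ->
  quadrant (shell_arg (shell_point m k0) s0) ->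
  S x @[x --> F] --> s0 -> K x @[x --> F] --> k0 ->
  causality_integrand f (S x) Z (shell_point m (K x)) @[x --> F] -->
    causality_integrand f s0 Z (shell_point m k0).
Proof.
move=> FF fC q0 Ss Kk.
have Pp i : shell_point m (K x) 0 i @[x --> F] --> shell_point m k0 0 i.
  exact: shell_point_cvg.
have S12 : (S x).1 @[x --> F] --> s0.1 by apply: cvg_comp Ss _; exact: cvg_fst.
have S3 i j : (S x).2 i j @[x --> F] --> s0.2 i j.
  apply: (@cvg_comp _ _ _ (fun x => (S x).2) (fun T : 'M[R]_4 => T i j)).
    by apply: cvg_comp Ss _; exact: cvg_snd.
  exact: coord_continuous.
have S1 : (S x).1.1 @[x --> F] --> s0.1.1 by apply: cvg_comp S12 _; exact: cvg_fst.
have S2 i : (S x).1.2 i 0 @[x --> F] --> s0.1.2 i 0.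
  apply: (@cvg_comp _ _ _ (fun x => (S x).1.2) (fun T : 'cV[R]_4 => T i 0)).
    by apply: cvg_comp S12 _; exact: cvg_snd.
  exact: coord_continuous.
have zz : shell_arg (shell_point m (K x)) (S x) @[x --> F] -->
    shell_arg (shell_point m k0) s0.
  have z1 : (S x).1.1 + quad (shell_point m (K x)) (S x).2 @[x --> F] -->
      s0.1.1 + quad (shell_point m k0) s0.2 by apply: cvgD => //; exact: quad_cvg.
  exact (cvg_pair z1 (pairing_cvg FF Pp S2)).
have da : Z.1.1 + quad (shell_point m (K x)) Z.2 @[x --> F] -->
    Z.1.1 + quad (shell_point m k0) Z.2.
  apply: cvgD; first exact: cvg_cst.
  by apply: quad_cvg => // i j; exact: cvg_cst.
have db : pairing (shell_point m (K x)) Z.1.2 @[x --> F] -->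
    pairing (shell_point m k0) Z.1.2.
  by apply: pairing_cvg => // i; exact: cvg_cst.
have D3 u v w : 'D_u ('D_v ('D_w (f : _ -> R^o)))
    (shell_arg (shell_point m (K x)) (S x)) @[x --> F] -->
    'D_u ('D_v ('D_w (f : _ -> R^o))) (shell_arg (shell_point m k0) s0).
  exact (quadrant_cvg FF (Ck_continuous (Ck_derive (Ck_derive
    (Ck_derive fC (I : setT w)) (I : setT v)) (I : setT u))) q0 zz).
rewrite /causality_integrand.
apply: cvgD; first apply: cvgD.
- exact (cvgM (D3 _ _ _) (cvgM da da)).
- exact (cvgM (cvgM (cvgM (cvg_cst _) (D3 _ _ _)) da) db).
- exact (cvgM (D3 _ _ _) (cvgM db db)).
Qed.

End Continuity.

Section Negativity.
Context {R : realType}.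
Implicit Types (p : 'rV[R]_4) (t : 'cV[R]_4) (s Z : fields R) (k : R * R * R).

(** Complete the square after multiplying by A; if A = 0 the discriminant condition forces B = 0. *)
Lemma binary_quadratic_ge0 (A B C a b : R) : 0 <= A -> 0 <= C ->
  B ^+ 2 <= C * A -> 0 <= A * a ^+ 2 + 2 * B * a * b + C * b ^+ 2.
Proof.
move=> A0 C0 BAC; have [A_gt0|A_le0] := ltP 0 A.
  rewrite -(pmulr_rge0 _ A_gt0).
  have -> : A * (A * a ^+ 2 + 2 * B * a * b + C * b ^+ 2) =
    (A * a + B * b) ^+ 2 + (C * A - B ^+ 2) * b ^+ 2 by ring.
  by rewrite addr_ge0 ?sqr_ge0 // mulr_ge0 ?sqr_ge0 // subr_ge0.
have A_eq0 : A = 0 by apply/eqP; rewrite eq_le A_le0 A0.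
move: BAC; rewrite A_eq0 mulr0 => B0.
have -> : B = 0 by apply/eqP; rewrite -sqrf_eq0 eq_le B0 sqr_ge0.
by rewrite mul0r mulr0 !mul0r !add0r mulr_ge0 ?sqr_ge0.
Qed.

Lemma causality_integrand_ge0 (f : R^o * R^o -> R) s Z p :
  manifestly_causal f -> quadrant (shell_arg p s) ->
  0 <= causality_integrand f s Z p.
Proof.
move=> fc qz; have [A0 C0 BAC] := fc _ qz.
exact (binary_quadratic_ge0 _ _ A0 C0 BAC).
Qed.

Lemma open_future_timelike : open (@future_timelike R).
Proof.
have cc i : continuous (fun v : 'cV[R]_4 => v i 0 : R).
  by move=> v; exact: coord_continuous.
have c2 i : continuous (fun v : 'cV[R]_4 => v i 0 ^+ 2 : R).
  exact (fun v => cvgM (cc i v) (cc i v)).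
pose q (v : 'cV[R]_4) : R := v 0 0 ^+ 2 -
  (v 1 0 ^+ 2 + v (inord 2) 0 ^+ 2 + v (inord 3) 0 ^+ 2).
have qc : continuous q.
  exact (fun v => cvgB (c2 0 v) (cvgD (cvgD (c2 1 v) (c2 _ v)) (c2 _ v))).
have -> : @future_timelike R = (q @^-1` [set x | 0 < x]) `&`
    ((fun v : 'cV[R]_4 => v 0 0) @^-1` [set x | 0 < x]).
  apply/funext => v; apply/propext; split.
    by move=> /future_timelikeE[? ?]; split=> //=; rewrite /q subr_gt0.
  by case=> /= qv v0; apply/future_timelikeE; split=> //; rewrite -subr_gt0.
by apply: openI; apply: open_comp (@open_gt R 0) => v _; [exact: qc|exact: cc].
Qed.

Lemma equilibrium_nbhs s : equilibrium s -> exists2 d, 0 < d &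
  forall y, `|y - s| < d -> y.1.1 < 0 /\ future_timelike y.1.2.
Proof.
case=> -[s0 st _] _.
apply: (@open_normP _ _ [set y : fields R | y.1.1 < 0 /\ future_timelike y.1.2]) => //.
have c1 : continuous (fun y : fields R => y.1) by move=> y; exact: cvg_fst.
apply: openI.
  apply: (@open_comp _ _ (fun y : fields R => y.1.1) _ _ (@open_lt R 0)) => y _.
  by apply: cvg_comp (c1 y) _; exact: cvg_fst.
apply: (@open_comp _ _ (fun y : fields R => y.1.2) _ _ open_future_timelike) => y _.
by apply: cvg_comp (c1 y) _; exact: cvg_snd.
Qed.

End Negativity.

(** * The third derivative of the generating function at equilibrium *)

Section Main_inequality.
Context {R : realType}.
Implicit Types (p : 'rV[R]_4) (t : 'cV[R]_4) (s Z : fields R) (k : R * R * R).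

(** Formally the density in d^3 k of - D_t D_Z D_Z chi; the minus sign compensates p_a t^a < 0, and
    the energy comes from the invariant volume element. *)
Definition flux_density (m : R) (f : R^o * R^o -> R) t Z s k : R :=
  - pairing (shell_point m k) t * causality_integrand f s Z (shell_point m k)
    / energy m k.

Lemma linear_subspace_perturbation : linear_subspace (@perturbation R).
Proof.
by split; [exact: sym_tracefree0|move=> a u v; exact: sym_tracefree_comb].
Qed.

Lemma flux_density_ge0 (m : R) f t Z s k :
  0 < m -> manifestly_causal f -> 0 < t 0 0 ->
  t 1 0 ^+ 2 + t (inord 2) 0 ^+ 2 + t (inord 3) 0 ^+ 2 <= t 0 0 ^+ 2 ->
  quadrant (shell_arg (shell_point m k) s) -> 0 <= flux_density m f t Z s k.
Proof.
move=> m0 fc t0 tt qs; have E0 := energy_gt0 k m0.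
have pt := pairing_shell_lt0 k m0 t0 tt.
rewrite divr_ge0 ?(ltW E0) // mulr_ge0 ?oppr_ge0 ?(ltW pt) //.
exact (causality_integrand_ge0 Z fc qs).
Qed.

(** Nondegeneracy supplies a momentum where the form is nonzero, hence positive by manifest
    causality; continuity preserves half of the value nearby. *)
Lemma flux_density_lower_bound (m : R) f t Z s0 :
  0 < m -> Ck 3 (@quadrant R) setT f -> manifestly_causal f ->
  causality_nondegenerate m f -> 0 < t 0 0 ->
  t 1 0 ^+ 2 + t (inord 2) 0 ^+ 2 + t (inord 3) 0 ^+ 2 <= t 0 0 ^+ 2 ->
  equilibrium s0 -> perturbation Z -> Z != 0 ->
  exists k0 c d, [/\ 0 < c, 0 < d & forall s k, `|s - s0| < d ->
    `|k.1.1 - k0.1.1| < d -> `|k.1.2 - k0.1.2| < d -> `|k.2 - k0.2| < d ->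
    c <= flux_density m f t Z s k].
Proof.
move=> m0 fC fc fnd t0 tt es0 WZ Z0.
have [p /(mass_shellP _ m0)[k0 ->] CI0] := fnd s0 Z es0 WZ Z0.
have q0 : quadrant (shell_arg (shell_point m k0) s0).
  have [[s00 /future_timelikeE[st st0] _] s02] := es0; split=> /=.
    by rewrite s02 /quad mulmx0 mul0mx mxE addr0.
  exact: pairing_shell_lt0 m0 st0 (ltW st).
have CIgt : 0 < causality_integrand f s0 Z (shell_point m k0).
  by rewrite lt_neqAle eq_sym CI0 (causality_integrand_ge0 Z fc q0).
have E0 := energy_gt0 k0 m0; have pt := pairing_shell_lt0 k0 m0 t0 tt.
have F0 : 0 < flux_density m f t Z s0 k0.
  by rewrite divr_gt0 // mulr_gt0 // oppr_gt0.
have Sc : (x.1 : fields R) @[x --> ((s0, k0) : fields R * (R * R * R))] --> s0.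
  exact: cvg_fst.
have Kc : (x.2 : R * R * R) @[x --> ((s0, k0) : fields R * (R * R * R))] --> k0.
  exact: cvg_snd.
have Fc : flux_density m f t Z x.1 x.2 @[x --> ((s0, k0) : fields R * (R * R * R))]
    --> flux_density m f t Z s0 k0.
  have c1 := causality_integrand_cvg (Z := Z) _ fC q0 Sc Kc.
  have c2 : pairing (shell_point m x.2) t
      @[x --> ((s0, k0) : fields R * (R * R * R))] --> pairing (shell_point m k0) t.
    apply: pairing_cvg => i; [exact: shell_point_cvg|exact: cvg_cst].
  have c3 := energy_cvg (m := m) _ Kc.
  exact (cvgM (cvgM (cvgN c2) (c1 _)) (cvgV (lt0r_neq0 E0) (c3 _))).
pose c := flux_density m f t Z s0 k0 / 2.
have c_lt : c < flux_density m f t Z s0 k0 by rewrite /c; lra.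
have : \forall x \near ((s0, k0) : fields R * (R * R * R)),
    c < flux_density m f t Z x.1 x.2.
  exact: cvgr_gt Fc _ c_lt.
case/nbhs_ballP => d /= d0 H; exists k0, c, d; split=> //; first by rewrite divr_gt0.
move=> s k sd k1 k2 k3; apply/ltW/(H (s, k)); split=> /=.
  by rewrite -ball_normE /ball_ /= distrC.
by split; [split|]; rewrite /ball /= distrC.
Qed.

(** Null [t] are included: testing against them is what later makes E^a strictly timelike. *)
Lemma third_derivative_lt0 (m : R) f chi O t Z s0 :
  0 < m -> Ck 3 (@quadrant R) setT f -> manifestly_causal f ->
  causality_nondegenerate m f ->
  (forall s, states s -> Cminus s.2 -> shell_integrable m (integrand f s) /\
     chi s = shell_integral m (integrand f s)) ->
  open O -> (@equilibrium R) `<=` O -> Ck 3 O (@perturbation R) chi ->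
  0 < t 0 0 ->
  t 1 0 ^+ 2 + t (inord 2) 0 ^+ 2 + t (inord 3) 0 ^+ 2 <= t 0 0 ^+ 2 ->
  equilibrium s0 -> perturbation Z -> Z != 0 ->
  'D_(spatial t) ('D_Z ('D_Z (chi : _ -> R^o))) s0 < 0.
Proof.
move=> m0 fC fc fnd chiE oO eO chiC t0 tt es0 WZ Z0.
have WL := linear_subspace_perturbation.
have We : perturbation (spatial t) by exact: sym_tracefree0.
have Os0 := eO _ es0.
have Ws0 : perturbation s0 by case: es0 => -[].
have [k0 [c [d1 [c0 d10 HF]]]] :=
  flux_density_lower_bound m0 fC fc fnd t0 tt es0 WZ Z0.
have [d2 d20 Hst] := equilibrium_nbhs es0.
have [d3 d30 HO] := open_normP oO Os0.
have [mB Br] := lebesgue3_box k0 d10; set r := (2 * d1) ^+ 3 in Br.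
have r0 : 0 < r by rewrite exprn_gt0 // mulr_gt0.
have cr0 : 0 < c * r by rewrite mulr_gt0.
have C3 : Ck 0 O (@perturbation R) ('D_(spatial t) ('D_Z ('D_Z (chi : _ -> R^o)))).
  exact (Ck_derive (Ck_derive (Ck_derive chiC WZ) WZ) We).
(* The tolerance c r is the bound to be obtained near s0, so the strict inequality survives the
   passage back to s0. *)
have [d4 d40 HC] := within_continuousP (Ck_continuous C3) (conj Os0 Ws0) cr0.
(* The factor makes h *: V0 outweigh the two steps h *: Z of the difference. *)
pose V0 : fields R := (0, 0, (2 * (\sum_i \sum_j `|Z.2 i j|)) *: cone_center).
have WV0 : perturbation V0.
  rewrite /perturbation /= -[_ *: _]addr0.
  exact: sym_tracefree_comb cone_center_sym_tracefree sym_tracefree0.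
pose d := Num.min d1 (Num.min d2 (Num.min d3 d4)).
have d0 : 0 < d by rewrite !lt_min d10 d20 d30.
(* The displacement from s0 consists of the shift, two steps along Z and one along t, so its norm is
   less than h M. *)
pose M := 1 + `|V0| + 2 * `|Z| + `|spatial t|.
have M0 : 0 < M by rewrite !ltr_wpDr // mulr_ge0.
pose h := d / M / 2.
have h0 : 0 < h by rewrite !divr_gt0.
have hM : h * M < d.
  have -> : h * M = d / 2 by rewrite /h; field; rewrite gt_eqF.
  by lra.
clearbody h.
pose x := s0 + h *: V0.
pose pt a b c' := x + c' *: Z + b *: Z + a *: spatial t.
have close a b c' : 0 <= a <= h -> 0 <= b <= h -> 0 <= c' <= h ->
    `|pt a b c' - s0| < d.
  move=> /andP[a0 ah] /andP[b0 bh] /andP[c'0 c'h].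
  have -> : pt a b c' - s0 = h *: V0 + (c' + b) *: Z + a *: spatial t.
    by rewrite /pt /x -!addrA [s0 + _]addrC -!addrA addNr addr0 scalerDl !addrA.
  apply: le_lt_trans hM; apply: le_trans (ler_normD _ _) _.
  have := ler_normD (h *: V0) ((c' + b) *: Z); rewrite !normrZ.
  rewrite (ger0_norm (ltW h0)) (ger0_norm (addr_ge0 c'0 b0)) (ger0_norm a0).
  have := ler_wpM2r (normr_ge0 Z) (lerD c'h bh).
  have := ler_wpM2r (normr_ge0 (spatial t)) ah; rewrite /M; move: h0.
  by move: `|_ + _| `|V0| `|Z| `|spatial t| => *; lra.
have Wpt a b c' : perturbation (pt a b c').
  do 3 (apply: (linear_subspaceD WL); last exact: linear_subspaceZ).
  by apply: (linear_subspaceD WL) => //; exact: linear_subspaceZ.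
(* Holding for all covectors, this gives membership in C^- through null p and negativity of x
   through p on the shell. *)
have quad_pt a b c' p : 0 <= b <= h -> 0 <= c' <= h -> quad p (pt a b c').2 <= 0.
  move=> /andP[b0 bh] /andP[c'0 c'h].
  have -> : (pt a b c').2 = (h * (2 * (\sum_i \sum_j `|Z.2 i j|))) *: cone_center +
      (c' + b) *: Z.2.
    by rewrite /= es0.2 add0r scalerA scaler0 addr0 scalerDl addrA.
  apply: cone_perturbation; first exact: ltW.
  by rewrite addr_ge0 //=; lra.
have states_pt a b c' : 0 <= a <= h -> 0 <= b <= h -> 0 <= c' <= h ->
    states (pt a b c').
  move=> aI bI cI; have := close _ _ _ aI bI cI.
  rewrite !lt_min => /and4P[_ /Hst[p1 p2] _ _]; split=> //.
  exact: Wpt.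
have quadrant_pt a b c' k : 0 <= a <= h -> 0 <= b <= h -> 0 <= c' <= h ->
    quadrant (shell_arg (shell_point m k) (pt a b c')).
  move=> aI bI cI; have [p1 /future_timelikeE[p2 p2'] _] := states_pt _ _ _ aI bI cI.
  split; rewrite /=; last exact: pairing_shell_lt0 m0 p2' (ltW p2).
  by rewrite -[ltRHS]addr0 ltr_leD //; exact: quad_pt.
have D_pt a b c' : 0 <= a <= h -> 0 <= b <= h -> 0 <= c' <= h ->
    (O `&` (@perturbation R)) (pt a b c').
  move=> aI bI cI; split; last exact: Wpt.
  by apply: HO; have := close _ _ _ aI bI cI; rewrite !lt_min => /and4P[].
have h0h : 0 <= h <= h by rewrite lexx ltW.
have h00 : 0 <= (0 : R) <= h by rewrite lexx ltW.
pose J p s := integrand f s p.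
have rep a b c' : 0 <= a <= h -> 0 <= b <= h -> 0 <= c' <= h ->
    represented_at m chi J (pt a b c').
  move=> aI bI cI; apply: chiE; first exact: states_pt.
  by split; [exact: Wpt|move=> l _; exact: quad_pt].
have rep1 b c' : 0 <= b <= h -> 0 <= c' <= h ->
    represented_at m (difference (h *: spatial t) chi)
      (fun p => difference (h *: spatial t) (J p)) (pt 0 b c').
  move=> bI cI; apply: represented_difference; first exact: rep.
  by have := rep h b c' h0h bI cI; rewrite /pt scale0r addr0.
have rep2 c' : 0 <= c' <= h ->
    represented_at m (difference (h *: Z) (difference (h *: spatial t) chi))
      (fun p => difference (h *: Z) (difference (h *: spatial t) (J p))) (pt 0 0 c').
  move=> cI; apply: represented_difference; first exact: rep1.
  by have := rep1 h c' h0h cI; rewrite /pt !scale0r !addr0.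
have [I3 E3] : represented_at m
    (difference (h *: Z) (difference (h *: Z) (difference (h *: spatial t) chi)))
    (fun p => difference (h *: Z) (difference (h *: Z)
      (difference (h *: spatial t) (J p)))) x.
  have := rep2 0 h00; rewrite /pt !scale0r !addr0 => r0'.
  apply: (represented_difference r0').
  by have := rep2 h h0h; rewrite /pt !scale0r !addr0.
have [a [b [c' [aI bI cI Echi]]]] : exists a b c', [/\ 0 <= a <= h, 0 <= b <= h,
    0 <= c' <= h & difference (h *: Z) (difference (h *: Z)
      (difference (h *: spatial t) (chi : _ -> R^o))) x =
    h ^+ 3 * 'D_(spatial t) ('D_Z ('D_Z (chi : _ -> R^o))) (pt a b c')].
  apply: (third_difference (ltW h0) D_pt) => y Dy; split.
  - exact (Ck_derivable chiC Dy WZ).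
  - exact (Ck_derivable (Ck_derive chiC WZ) Dy WZ).
  - exact (Ck_derivable (Ck_derive (Ck_derive chiC WZ) WZ) Dy We).
(* The intermediate point depends on k and is unrelated to the one for chi, hence the uniformity of
   [HF] in the state. *)
have Jk k : exists a b c', [/\ 0 <= a <= h, 0 <= b <= h, 0 <= c' <= h &
    - difference (h *: Z) (difference (h *: Z) (difference (h *: spatial t)
      (J (shell_point m k)))) x / energy m k =
    h ^+ 3 * flux_density m f t Z (pt a b c') k].
  have [a1 [b1 [c1 [a1I b1I c1I EJ]]]] := integrand_third_difference fC (ltW h0)
    (fun a b c' aI bI cI => quadrant_pt a b c' k aI bI cI).
  by exists a1, b1, c1; split=> //; rewrite EJ /flux_density -mulrN -mulNr -!mulrA.
have [I4 E4] := shell_integralN I3.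
have := @shell_integral_ge _ m _ _ (h ^+ 3 * c) r I4 mB Br.
rewrite E4 -E3 Echi => H.
have h30 : 0 < h ^+ 3 by rewrite exprn_gt0.
have {H} : h ^+ 3 * c * r <=
    - (h ^+ 3 * 'D_(spatial t) ('D_Z ('D_Z (chi : _ -> R^o))) (pt a b c')).
  apply: H; first by rewrite mulr_ge0 // ltW.
    move=> k; have [a1 [b1 [c1 [a1I b1I c1I ->]]]] := Jk k.
    rewrite mulr_ge0 ?(ltW h30) //.
    by apply: flux_density_ge0 => //; exact: quadrant_pt.
  move=> k [[k1 k2] k3]; have [a1 [b1 [c1 [a1I b1I c1I ->]]]] := Jk k.
  rewrite ler_wpM2l ?(ltW h30) //.
  have := close _ _ _ a1I b1I c1I; rewrite lt_min => /andP[c1d _].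
  have itv_dist (y z : R) : (`]z - d1, z + d1[ y -> `|y - z| < d1)%classic.
    by rewrite /= in_itv /= ltr_distl.
  by apply: (HF _ _ c1d); exact: itv_dist.
(* After division by h^3 the derivative at the intermediate point is at most - c r, and at s0 it is
   larger by less than c r. *)
rewrite -mulrN -mulrA ler_pM2l // lerNr => Dle.
have := close _ _ _ aI bI cI; rewrite !lt_min => /and4P[_ _ _].
move=> /(HC _ (D_pt _ _ _ aI bI cI)); rewrite distrC ltr_distl => /andP[_ DD].
apply: lt_le_trans DD _; rewrite -(addNr (c * r)); exact: lerD Dle (lexx _).
Qed.

End Main_inequality.

(** * Coordinates on the perturbations *)

Section Coordinates.
Context {R : realType}.

Lemma linear_row_sum (V : lmodType R) n (f : 'rV[R]_n -> V) :
  linear f -> forall c, f c = \sum_i c 0 i *: f (delta_mx 0 i).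
Proof.
move=> fl c; rewrite {1}[c]row_sum_delta.
have f0 : f 0 = 0.
  by have := fl (-1) 0 0; rewrite scaler0 addr0 scaleN1r addNr.
elim/big_rec2: _ => [//|i y1 y2 _ <-]; exact: fl.
Qed.

Lemma linear_row_continuous (V : normedModType R) n (f : 'rV[R]_n -> V) :
  linear f -> continuous f.
Proof.
move=> /linear_row_sum/funext -> c.
apply: (sum_cvg (F := nbhs c)) => i; apply: cvgZl; exact: coord_continuous.
Qed.

Definition coord_dim := (1 + (4 + 4 * 4))%N.

(** Identifies [fields] with row vectors of length 21, where closed bounded sets are compact. *)
Definition unpack (c : 'rV[R]_coord_dim) : fields R :=
  (lsubmx (c : 'rV_(1 + (4 + 4 * 4))) 0 0,
   (lsubmx (rsubmx (c : 'rV_(1 + (4 + 4 * 4)))))^T,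
   vec_mx (rsubmx (rsubmx (c : 'rV_(1 + (4 + 4 * 4)))))).

Definition pack (Z : fields R) : 'rV[R]_coord_dim :=
  row_mx (Z.1.1 : R)%:M (row_mx Z.1.2^T (mxvec Z.2)).

Lemma packK Z : unpack (pack Z) = Z.
Proof.
case: Z => [[z v] T]; rewrite /unpack /pack row_mxKl row_mxKr row_mxKl row_mxKr.
by rewrite mxvecK trmxK mxE eqxx mulr1n.
Qed.

Lemma unpackK c : pack (unpack c) = c.
Proof. by rewrite /pack /unpack /= -mx11_scalar trmxK vec_mxK !hsubmxK. Qed.

Lemma pack0 : pack 0 = 0.
Proof.
by rewrite /pack /= raddf0 !linear0 !row_mx0.
Qed.

Lemma unpack_linear : linear unpack.
Proof.
move=> a u v; rewrite /unpack !linearP /=; congr (_, _, _).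
by rewrite !mxE.
Qed.

(** A linear projection onto the symmetric trace-free tensors; the factor 1/4 is the inverse of the
    trace of [eta *m eta]. *)
Definition sym_tracefree_part (T : 'M[R]_4) : 'M[R]_4 :=
  2^-1 *: (T + T^T) - (4^-1 * \tr (Defs.eta *m T)) *: Defs.eta.

Lemma sym_tracefree_part_linear : linear sym_tracefree_part.
Proof.
move=> a S T; rewrite /sym_tracefree_part mulmxDr -scalemxAr mxtraceD mxtraceZ.
by apply/matrixP => i j; rewrite !mxE; ring.
Qed.

Lemma sym_tracefree_partP T : sym_tracefree (sym_tracefree_part T).
Proof.
have etaT : (Defs.eta : 'M[R]_4)^T = Defs.eta by exact: tr_diag_mx.
have tr2 : \tr (Defs.eta *m Defs.eta : 'M[R]_4) = 4.
  rewrite mulmx_diag mxtrace_diag.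
  rewrite (eq_bigr (fun=> 1)) => [|i _]; first by rewrite sumr_const card_ord.
  by rewrite !mxE; case: ifP => _; ring.
split.
  rewrite /sym_tracefree_part linearB /= !linearZ /= linearD /= trmxK etaT.
  by rewrite [T^T + T]addrC.
rewrite /sym_tracefree_part mulmxBr -!scalemxAr mulmxDr linearB /= !linearZ /=.
rewrite linearD /= tr2 -[\tr (_ *m T^T)]mxtrace_tr trmx_mul trmxK etaT.
rewrite [\tr (T *m _)]mxtrace_mulC -[_ *: - 4]/(_ * _).
by field.
Qed.

Lemma sym_tracefree_part_id T : sym_tracefree T -> sym_tracefree_part T = T.
Proof.
case=> T1 T2; rewrite /sym_tracefree_part T1 T2 mulr0 scale0r subr0.
by apply/matrixP => i j; rewrite !mxE; field.
Qed.

Definition project (Z : fields R) : fields R := (Z.1, sym_tracefree_part Z.2).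

Lemma project_linear : linear project.
Proof. by move=> a u v; rewrite /project /= sym_tracefree_part_linear. Qed.

Lemma projectP Z : perturbation (project Z).
Proof. exact: sym_tracefree_partP. Qed.

Lemma project_id Z : perturbation Z -> project Z = Z.
Proof. by case: Z => Z T /sym_tracefree_part_id /= TT; rewrite /project /= TT. Qed.

(** These span the perturbations without being a basis: 21 vectors in a space of dimension 14. Only
    the expansion below is used. *)
Definition direction (i : 'I_coord_dim) : fields R :=
  project (unpack (delta_mx 0 i)).

Lemma direction_sum (c : 'rV[R]_coord_dim) : perturbation (unpack c) ->
  unpack c = \sum_i c 0 i *: direction i.
Proof.
move=> Wc; rewrite -[LHS](project_id Wc).
apply: (@linear_row_sum _ _ (fun c => project (unpack c))) => a u v.
by rewrite unpack_linear project_linear.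
Qed.

(** The perturbations are the fixed points of [project], that is, the zeros of a continuous linear
    map, hence closed. *)
Lemma compact_coord_sphere :
  compact [set c : 'rV[R]_coord_dim | `|c| = 1 /\ perturbation (unpack c)].
Proof.
apply: bounded_closed_compact.
  by exists 1; split; [exact: num_real|move=> x x1 c /= [-> _]; exact: ltW].
pose g c := unpack c - project (unpack c).
have gl : linear g.
  move=> a u v; rewrite /g unpack_linear project_linear.
  by rewrite scalerBr opprD addrACA.
have -> : [set c : 'rV[R]_coord_dim | `|c| = 1 /\ perturbation (unpack c)] =
    (fun c : 'rV[R]_coord_dim => `|c|) @^-1` [set 1] `&` g @^-1` [set 0].
  apply/funext => c; apply/propext; split=> -[c1 c2]; split=> //=.
    by rewrite /g project_id // subrr.
  by move/eqP: c2; rewrite subr_eq0 => /eqP ->; exact: projectP.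
apply: closedI.
  apply: closed_comp => [c _|]; first exact: norm_continuous.
  exact: closed_eq.
apply: closed_comp => [c _|]; first exact: linear_row_continuous.
by apply: accessible_closed_set1; apply: hausdorff_accessible; exact: norm_hausdorff.
Qed.

End Coordinates.

(** * Causality near equilibrium *)

Section Causality.
Context {R : realType}.
Implicit Types (chi : fields R -> R) (s Z : fields R).

(** Raising the index flips the sign of the time component, and the factor 1/2 does not affect the
    conditions. *)
Lemma future_timelike_E_vector chi s Z :
  future_timelike (E_vector chi s Z) <->
  mform chi s 0 Z Z < 0 /\ mform chi s 1 Z Z ^+ 2 +
    mform chi s (inord 2) Z Z ^+ 2 + mform chi s (inord 3) Z Z ^+ 2 <
    mform chi s 0 Z Z ^+ 2.
Proof.
have e2 : (inord 2 == 0 :> 'I_4) = false by rewrite -val_eqE /= inordK.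
have e3 : (inord 3 == 0 :> 'I_4) = false by rewrite -val_eqE /= inordK.
have EE a : E_vector chi s Z a 0 =
    2^-1 * ((if a == 0 then -1 else 1) * mform chi s a Z Z).
  by rewrite mxE eta_mulE mxE.
split.
  move/future_timelikeE; rewrite !EE eqxx e2 e3 /= => -[].
  move: (mform chi s 0 Z Z) (mform chi s 1 Z Z) (mform chi s (inord 2) Z Z)
    (mform chi s (inord 3) Z Z) => a b c d H1 H2.
  by split; lra.
move=> H; apply/future_timelikeE; rewrite !EE eqxx e2 e3 /=; move: H.
move: (mform chi s 0 Z Z) (mform chi s 1 Z Z) (mform chi s (inord 2) Z Z)
  (mform chi s (inord 3) Z Z) => a b c d [H1 H2].
by split; lra.
Qed.

Lemma derive_spatial O (g : fields R -> R^o) s t :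
  open O -> Ck 1 O (@perturbation R) g -> (O `&` @perturbation R) s ->
  'D_(spatial t) g s = \sum_a t a 0 * 'D_(spatial (delta_mx a 0)) g s.
Proof.
move=> oO gC Ds.
have -> : spatial t = \sum_a t a 0 *: spatial (delta_mx a 0).
  have -> : \sum_a t a 0 *: spatial (delta_mx a 0) =
      spatial (\sum_a t a 0 *: delta_mx a 0).
    elim/big_rec2: _ => [//|a y1 y2 _ ->].
    by rewrite /spatial; congr (_, _, _); rewrite /= ?scaler0 ?addr0.
  congr (_, _, _); rewrite /=; apply/colP => i; rewrite summxE (bigD1 i) //= big1.
    by rewrite !mxE !eqxx mulr1 addr0.
  by move=> j ji; rewrite !mxE eq_sym (negbTE ji) mulr0.
apply: (derive_sumv _ oO linear_subspace_perturbation gC Ds) => a.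
exact: sym_tracefree0.
Qed.

(** A covector negative on all nonzero future causal vectors is timelike: the time axis gives the
    sign of u0, and one null vector the size. *)
Lemma equilibrium_causal (m : R) f chi O s :
  0 < m -> Ck 3 (@quadrant R) setT f -> manifestly_causal f ->
  causality_nondegenerate m f ->
  (forall s, states s -> Cminus s.2 -> shell_integrable m (integrand f s) /\
     chi s = shell_integral m (integrand f s)) ->
  open O -> (@equilibrium R) `<=` O -> Ck 3 O (@perturbation R) chi ->
  equilibrium s -> causal_at chi s.
Proof.
move=> m0 fC fc fnd chiE oO eO chiC es Z WZ Z0; apply/future_timelike_E_vector.
have Ds : (O `&` @perturbation R) s by split; [exact: eO|case: es => -[]].
have neg (t : 'cV[R]_4) : 0 < t 0 0 ->
    t 1 0 ^+ 2 + t (inord 2) 0 ^+ 2 + t (inord 3) 0 ^+ 2 <= t 0 0 ^+ 2 ->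
    \sum_a t a 0 * mform chi s a Z Z < 0.
  move=> t0 tt.
  have := third_derivative_lt0 m0 fC fc fnd chiE oO eO chiC t0 tt es WZ Z0.
  by rewrite (derive_spatial _ oO (Ck_derive (Ck_derive chiC WZ) WZ) Ds).
pose u a := mform chi s a Z Z; rewrite -!/(u _).
have {}neg (x0 x1 x2 x3 : R) : 0 < x0 -> x1 ^+ 2 + x2 ^+ 2 + x3 ^+ 2 <= x0 ^+ 2 ->
    x0 * u 0 + x1 * u 1 + x2 * u (inord 2) + x3 * u (inord 3) < 0.
  move=> h1 h2; have := neg (\col_a [:: x0; x1; x2; x3]`_a).
  by rewrite sum4E !mxE /= !inordK //=; apply.
move: (u 0) (u 1) (u (inord 2)) (u (inord 3)) neg => u0 u1 u2 u3 neg.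
have u0lt : u0 < 0.
  by have := neg 1 0 0 0; rewrite !expr0n /= expr1n !addr0 !mul0r !addr0 mul1r; apply.
split=> //; set N := u1 ^+ 2 + u2 ^+ 2 + u3 ^+ 2.
have N0 : 0 <= N by rewrite !addr_ge0 ?sqr_ge0.
(* If the spatial part vanishes, the null test vector below would be zero, so this case is
   separate. *)
have sN := sqr_sqrtr N0; have [N_eq0|N_gt0] := eqVneq N 0.
  by rewrite N_eq0 exprn_even_gt0 //= lt_eqF.
have n0 : 0 < Num.sqrt N by rewrite sqrtr_gt0 lt_neqAle eq_sym N_gt0.
move: (Num.sqrt N) sN n0 => n nN n0.
(* The null vector (n, u1, u2, u3) yields n u0 + n^2 < 0, that is, n < - u0. *)
have H : n * u0 + u1 * u1 + u2 * u2 + u3 * u3 < 0.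
  by apply: neg => //; rewrite nN.
have {}H : n < - u0 by rewrite -(ltr_pM2l n0); move: H nN; rewrite /N; lra.
rewrite -nN -[u0 ^+ 2]sqrrN ltr_pXn2r // ?nnegrE ?(ltW n0) //.
by rewrite oppr_ge0 ltW.
Qed.

Lemma causal_near_equilibrium chi O s :
  open O -> (@equilibrium R) `<=` O -> Ck 3 O (@perturbation R) chi ->
  equilibrium s -> causal_at chi s ->
  \forall s' \near within (@states R) (nbhs s), causal_at chi s'.
Proof.
move=> oO eO chiC es cs; set F := within _ _.
have WL := linear_subspace_perturbation (R := R).
have Ds : (O `&` @perturbation R) s by split; [exact: eO|case: es => -[]].
have FO : \forall s' \near F, (O `&` @perturbation R) s'.
  rewrite /F near_withinE; have : \forall s' \near s, O s'.
    exact: open_nbhs_nbhs (conj oO Ds.1).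
  by apply: filterS => y Oy [].
(* Finitely many continuous functions of the state; with the coordinates c they make [mform] a
   quadratic polynomial in c, jointly continuous in c and the state. *)
pose D a i j := 'D_(spatial (delta_mx a 0)) ('D_(direction j)
  ('D_(direction i) (chi : _ -> R^o))) : fields R -> R^o.
have DC a i j : Ck 0 O (@perturbation R) (D a i j).
  exact (Ck_derive (Ck_derive (Ck_derive chiC (projectP _)) (projectP _))
    (sym_tracefree0 : perturbation (spatial _))).
have Dcvg a i j : D a i j s' @[s' --> F] --> D a i j s.
  move=> A nA; have : \forall y \near within (O `&` @perturbation R) (nbhs s),
    A (D a i j y) := within_continuous_cvg (Ck_continuous (DC a i j)) Ds nA.
  rewrite near_withinE => nD.
  have : \forall y \near F, A (D a i j y); last by [].
  move: FO; rewrite /F !near_withinE.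
  by apply: filterS2 nD => y yA yO /yO; exact: yA.
pose q a (c : 'rV[R]_coord_dim) (y : fields R) : R :=
  \sum_i c 0 i * (\sum_j c 0 j * D a i j y : R).
have qE a c y : (O `&` @perturbation R) y -> perturbation (unpack c) ->
    mform chi y a (unpack c) (unpack c) = q a c y.
  move=> Dy Wc; rewrite /mform (direction_sum Wc).
  exact (derive3_sumv _ oO WL chiC Dy
    (sym_tracefree0 : perturbation (spatial (delta_mx a 0))) (fun i => projectP _)).
have qcvg a (c : 'rV[R]_coord_dim) :
    q a x.1 x.2 @[x --> filter_prod (nbhs c) F] --> q a c s.
  have cc i : (x.1 : 'rV[R]_coord_dim) 0 i @[x --> filter_prod (nbhs c) F] --> c 0 i.
    apply: (@cvg_comp _ _ _ fst (fun c : 'rV[R]_coord_dim => c 0 i)).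
      exact: cvg_fst.
    exact: coord_continuous.
  have DD i j : D a i j x.2 @[x --> filter_prod (nbhs c) F] --> D a i j s.
    by apply: cvg_comp cvg_snd _; exact: Dcvg.
  apply: sum_cvg => i; apply: cvgM; first exact: cc.
  by apply: sum_cvg => j; exact: cvgM (cc j) (DD i j).
have qZ a l c y : q a (l *: c) y = l ^+ 2 * q a c y.
  rewrite /q mulr_sumr; apply: eq_bigr => i _; rewrite mxE expr2 -!mulrA.
  congr (_ * _); rewrite mulrCA; congr (_ * _); rewrite mulr_sumr.
  by apply: eq_bigr => j _; rewrite mxE mulrA.
clearbody q.
pose P y (c : 'rV[R]_coord_dim) := q 0 c y < 0 /\
  q 1 c y ^+ 2 + q (inord 2) c y ^+ 2 + q (inord 3) c y ^+ 2 < q 0 c y ^+ 2.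
have /compact_near_coveringP cov := @compact_coord_sphere R.
(* The inequalities are open in (c, y) jointly, and compactness of the sphere gives one
   neighbourhood of s for all unit c. *)
have near_P : \forall y \near F, [set c : 'rV[R]_coord_dim |
    `|c| = 1 /\ perturbation (unpack c)] `<=` P y.
  apply: cov => c [c1 Wc].
  have c0 : unpack c != 0.
    apply/eqP => uc0; have := unpackK c; rewrite uc0 pack0 => c0.
    by move: c1; rewrite -c0 normr0 => /eqP; rewrite eq_sym oner_eq0.
  have /future_timelike_E_vector := cs _ Wc c0; rewrite !(qE _ _ _ Ds Wc) => -[h0 h1].
  have FF : Filter (filter_prod (nbhs c) F) by exact: filter_prod_filter.
  have h2 := cvgr_lt (FF := FF) _ (qcvg 0 c) _ h0.
  pose G (x : 'rV[R]_coord_dim * fields R) : R := q 0 x.1 x.2 ^+ 2 -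
    (q 1 x.1 x.2 ^+ 2 + q (inord 2) x.1 x.2 ^+ 2 + q (inord 3) x.1 x.2 ^+ 2).
  have sqc a : q a x.1 x.2 ^+ 2 @[x --> filter_prod (nbhs c) F] --> q a c s ^+ 2.
    exact (cvgM (qcvg a c) (qcvg a c)).
  have Gc : G x @[x --> filter_prod (nbhs c) F] --> G (c, s).
    exact (cvgB (sqc _) (cvgD (cvgD (sqc _) (sqc _)) (sqc _))).
  have h3 : \forall x \near filter_prod (nbhs c) F, 0 < G x.
    by apply: cvgr_gt Gc _ _; rewrite subr_gt0.
  have GP x : q 0 x.1 x.2 < 0 -> 0 < G x -> P x.2 x.1.
    by move=> x0 xG; exact (conj x0 (etrans (esym (subr_gt0 _ _)) xG)).
  exact (@filterS2 _ _ FF _ _ _ GP h2 h3).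
apply: filterS2 near_P FO => y Py Dy Z WZ Z0; apply/future_timelike_E_vector.
pose c := pack Z; have uc : unpack c = Z by exact: packK.
have c_gt0 : 0 < `|c|.
  rewrite normr_gt0; apply: contra Z0 => /eqP c0; apply/eqP.
  by rewrite -uc c0 -pack0 packK.
(* Normalizing c multiplies each [q] by l^2, so both inequalities carry over from the sphere to
   Z. *)
pose l := `|c|^-1; have l_gt0 : 0 < l by rewrite invr_gt0.
have Wlc : perturbation (unpack (l *: c)).
  have -> : unpack (l *: c) = l *: Z.
    by have := unpack_linear l c 0; rewrite -pack0 packK !addr0 uc pack0 addr0.
  exact: linear_subspaceZ.
have lc1 : `|l *: c| = 1.
  by rewrite normrZ ger0_norm ?(ltW l_gt0) // mulVf // gt_eqF.
have Wc : perturbation (unpack c) by rewrite uc.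
have := Py _ (conj lc1 Wlc); rewrite /P !qZ -uc !(qE _ _ _ Dy Wc).
have : 0 < l ^+ 2 by rewrite exprn_gt0.
move: (l ^+ 2) (q 0 c y) (q 1 c y) (q (inord 2) c y) (q (inord 3) c y).
move=> k q0 q1 q2 q3 k0.
by rewrite !exprMn -!mulrDr pmulr_rlt0 // ltr_pM2l // exprn_gt0.
Qed.

End Causality.

Theorem theorem2 (R : realType) (m : R) (f : R^o * R^o -> R)
    (chi : fields R -> R)
    (m_gt0 : 0 < m)
    (f_C3 : Ck 3 (@quadrant R) setT f)
    (f_eq : equilibrium_well_defined m f)
    (f_causal : manifestly_causal f)
    (f_nondeg : causality_nondegenerate m f)
    (chi_ext : extended_generating_function m f chi) :
  forall s : fields R, equilibrium s ->
    \forall s' \near within (@states R) (nbhs s), causal_at chi s'.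
Proof.
move=> s es; have [chiE [U [oU eU chiS]]] := chi_ext.
apply: (causal_near_equilibrium oU eU (chiS 3) es).
exact: (equilibrium_causal m_gt0 f_C3 f_causal f_nondeg chiE oU eU (chiS 3) es).
Qed.
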